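(* Let $n\geq 1$ be an integer, let $D_n$ be the $n$-th diamond poset, let $k$ be a field, $S_n=k[y_1,\ldots,y_{4n}]$ and $T_n=k[x_1,\ldots,x_{3n+1}]$, with $I_{\mathrm{LD}}(D_n)\subseteq S_n$ and $I_{2n+1}(D_n)\subseteq T_n$. Then: (i) $\operatorname{pd}(S_n/I_{\mathrm{LD}}(D_n))=n+1$ and $\operatorname{pd}(T_n/I_{2n+1}(D_n))=n+1$; (ii) $\operatorname{reg}(S_n/I_{\mathrm{LD}}(D_n))=3n-1$ and $\operatorname{reg}(T_n/I_{2n+1}(D_n))=2n$; (iii) $\operatorname{depth}(S_n/I_{\mathrm{LD}}(D_n))=3n-1$ and $\operatorname{depth}(T_n/I_{2n+1}(D_n))=2n$.
   Context: For posets $P,Q$ on disjoint ground sets, $P\oplus Q$ is the poset on the union in which $x<y$ iff $x<_P y$, or $x<_Q y$, or $x\in P$ and $y\in Q$. $D_1$ is the poset on $\{x_1,x_2,x_3,x_4\}$ with cover relations $x_1<x_2$, $x_1<x_3$, $x_2<x_4$, $x_3<x_4$. For $n\geq 2$, $D_n=\widetilde D_{n-1}\oplus D_1$, where $\widetilde D_{n-1}$ is $D_{n-1}$ with its maximum element removed. Thus $D_n$ consists of $n$ diamonds piled on top of each other; it has $3n+1$ elements, identified with $x_1,\ldots,x_{3n+1}$, and $4n$ cover relations (edges of the Hasse diagram), identified with $y_1,\ldots,y_{4n}$. $I_{\mathrm{LD}}(D_n)\subseteq S_n$ is the ideal generated by the monomials $\prod_{e\in\pi}y_e$, where $\pi$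 runs over the maximal saturated chains of $D_n$ and the product is over the cover relations (edges) of $\pi$. $I_{2n+1}(D_n)\subseteq T_n$ is the path ideal generated by the monomials $\prod_{v\in\pi}x_v$, where $\pi$ runs over the saturated chains with $2n+1$ elements (these are the maximal chains) and the product is over the elements of $\pi$. $\operatorname{pd}$, $\operatorname{reg}$ and $\operatorname{depth}$ are projective dimension, Castelnuovo–Mumford regularity and depth (with respect to the graded maximal ideal). *)

(* Defs.v *)
From HB Require Import structures.
From mathcomp Require Import all_boot all_order all_algebra.
From mathcomp Require Import boolp mpoly.

Set Implicit Arguments.
Unset Strict Implicit.
Unset Printing Implicit Defensive.

Import Order.TTheory GRing.Theory.

Local Open Scope order_scope.

Definition poset_display : Order.disp_t := Order.Disp tt tt.
Notation finPoset := (finPOrderType poset_display).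

Section OrdinalSum.
Variables P Q : finPoset.

Definition osum := (P + Q)%type.
HB.instance Definition _ := Finite.on osum.

Definition le_osum (u v : osum) : bool :=
  match u, v with
  | inl a, inl b => a <= b
  | inr a, inr b => a <= b
  | inl _, inr _ => true
  | inr _, inl _ => false
  end.

Fact le_osum_refl : reflexive le_osum.
Proof. by case=> a /=. Qed.

Fact le_osum_anti : antisymmetric le_osum.
Proof. by case=> a [] b //= /le_anti ->. Qed.

Fact le_osum_trans : transitive le_osum.
Proof. by case=> b [] a [] c //=; apply: le_trans. Qed.

HB.instance Definition _ := Order.Le_isPOrder.Build poset_display osum
  le_osum_refl le_osum_anti le_osum_trans.
End OrdinalSum.

Section RemoveMaximum.
Variable P : finPoset.

Definition is_maximum (x : P) : bool := [forall y, y <= x].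
Definition remove_max := {x : P | ~~ is_maximum x}.
HB.instance Definition _ := SubFinite.on remove_max.
HB.instance Definition _ :=
  [SubChoice_isSubPOrder of remove_max by <: with poset_display].
End RemoveMaximum.

(* The element of index i stands for x_{i+1}: 0 is the minimum, 3 is the     *)
(* maximum, and 1, 2 are incomparable.                                      *)
Definition diamond1 := 'I_4.
HB.instance Definition _ := Finite.on diamond1.

Definition le_diamond1 (x y : diamond1) : bool :=
  [|| x == y, val x == 0%N | val y == 3%N].

Fact le_diamond1_refl : reflexive le_diamond1.
Proof. by move=> x; rewrite /le_diamond1 eqxx. Qed.

Fact le_diamond1_anti : antisymmetric le_diamond1.
Proof.
by move=> [[|[|[|[|x]]]] xP] [[|[|[|[|y]]]] yP] //= H; apply: val_inj.
Qed.

Fact le_diamond1_trans : transitive le_diamond1.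
Proof.
by move=> [[|[|[|[|x]]]] xP] [[|[|[|[|y]]]] yP] [[|[|[|[|z]]]] zP].
Qed.

HB.instance Definition _ := Order.Le_isPOrder.Build poset_display diamond1
  le_diamond1_refl le_diamond1_anti le_diamond1_trans.

(* [diamond n] is D_n for n >= 1; the value at 0 is a dummy. *)
Fixpoint diamond (n : nat) : finPoset :=
  match n with
  | S (S _ as m) => osum (remove_max (diamond m)) diamond1
  | _ => diamond1
  end.

Section Chains.
Variable P : finPoset.

Definition covers (x y : P) : bool :=
  (x < y) && ~~ [exists z, (x < z) && (z < y)].

Definition hasse_edge := {e : P * P | covers e.1 e.2}.
HB.instance Definition _ := Finite.on hasse_edge.

(* A saturated chain is represented by the increasing sequence of its       *)
(* elements; maximality below is for inclusion of the sets of elements.     *)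
Definition saturated_chain (s : seq P) : bool := sorted covers s.

Definition maximal_saturated_chain (s : seq P) : Prop :=
  saturated_chain s /\
  forall t, saturated_chain t -> {subset s <= t} -> {subset t <= s}.

Definition edge_of_chain (s : seq P) (e : hasse_edge) : bool :=
  val e \in zip s (behead s).
End Chains.

Section OrdinalSumCovers.
Variables (P Q : finPoset).
Fact osum_leE (u v : osum P Q) : (u <= v) = le_osum u v. Proof. by []. Qed.
Fact osum_ltll a b : ((inl a : osum P Q) < inl b) = (a < b).
Proof. by rewrite !lt_neqAle. Qed.
Fact osum_ltrr a b : ((inr a : osum P Q) < inr b) = (a < b).
Proof. by rewrite !lt_neqAle. Qed.
Fact osum_ltlr a b : ((inl a : osum P Q) < inr b).
Proof. by rewrite lt_neqAle. Qed.
Fact osum_ltrl a b : ((inr a : osum P Q) < inl b) = false.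
Proof. by rewrite lt_neqAle andbF. Qed.
Definition osumE := (osum_ltll, osum_ltrr, osum_ltlr, osum_ltrl).

Definition is_maximal (x : P) := ~~ [exists y, x < y].
Definition is_minimal (x : Q) := ~~ [exists y, y < x].

Fact covers_osum_ll a b : covers (inl a : osum P Q) (inl b) = covers a b.
Proof.
rewrite /covers osumE; congr (_ && ~~ _).
apply/existsP/existsP => -[].
  by case=> z; rewrite !osumE ?andbF // => h; exists z.
by move=> z h; exists (inl z); rewrite !osumE.
Qed.
Fact covers_osum_rr a b : covers (inr a : osum P Q) (inr b) = covers a b.
Proof.
rewrite /covers osumE; congr (_ && ~~ _).
apply/existsP/existsP => -[].
  by case=> z; rewrite !osumE ?andbF // => h; exists z.
by move=> z h; exists (inr z); rewrite !osumE.
Qed.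
Fact covers_osum_rl a b : covers (inr a : osum P Q) (inl b) = false.
Proof. by rewrite /covers osumE. Qed.
Fact covers_osum_lr a b : covers (inl a : osum P Q) (inr b) = is_maximal a && is_minimal b.
Proof.
rewrite /covers osumE /= /is_maximal /is_minimal -negb_or; congr (~~ _).
apply/existsP/orP => [[[z|z]]|[/existsP[z h]|/existsP[z h]]].
- by rewrite !osumE andbT => h; left; apply/existsP; exists z.
- by rewrite !osumE => h; right; apply/existsP; exists z.
- by exists (inl z); rewrite !osumE h.
- by exists (inr z); rewrite !osumE h.
Qed.
End OrdinalSumCovers.

Definition num_covers (P : finPoset) := (\sum_(x : P) \sum_(y : P) covers x y)%N.

Fact card_hasse_edge (P : finPoset) : #|{: hasse_edge P}| = num_covers P.
Proof. by rewrite card_sig -sum1_card big_mkcond /num_covers pair_bigA. Qed.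

Fact diamond_has_maximum n : exists t : diamond n, is_maximum t.
Proof.
case: n => [|[|n]] /=.
- by exists (Ordinal (isT : 3 < 4)%N); apply/forallP => y; rewrite /Order.le /= /le_diamond1 !orbT.
- by exists (Ordinal (isT : 3 < 4)%N); apply/forallP => y; rewrite /Order.le /= /le_diamond1 !orbT.
exists (inr (Ordinal (isT : 3 < 4)%N)); apply/forallP => -[y|y]; rewrite osum_leE //=.
by rewrite /Order.le /= /le_diamond1 !orbT.
Qed.

Fact is_maximumE (P : finPoset) (t : P) : is_maximum t -> forall x, is_maximum x = (x == t).
Proof.
move=> /[dup] tm /forallP mt x; apply/idP/eqP => [/forallP mx|->//].
by apply: le_anti; rewrite mt mx.
Qed.

Fact sum_remove_max (P : finPoset) (t : P) (F : P -> nat) : is_maximum t ->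
  (\sum_(u : remove_max P) F (val u) + F t = \sum_x F x)%N.
Proof.
move=> tm; rewrite [RHS](bigD1 t) //= addnC; congr (_ + _)%N.
rewrite (eq_bigl (fun x => ~~ is_maximum x)); last by move=> x; rewrite (is_maximumE tm).
rewrite (reindex_omap (val : remove_max P -> P) insub) /=; last first.
  by move=> x h; rewrite insubT.
by apply: eq_bigl => u; rewrite (valP u) valK eqxx.
Qed.

Fact covers_remove_max (P : finPoset) (t : P) (u v : remove_max P) : is_maximum t ->
  covers u v = covers (val u) (val v).
Proof.
move=> tm; rewrite /covers; congr (_ && ~~ _).
apply/existsP/existsP => [[z h]|[z /andP[h1 h2]]]; first by exists (val z).
have zP : ~~ is_maximum z.
  apply/negP => /forallP /(_ (val v)) /(lt_le_trans h2); by rewrite ltxx.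
by exists (exist _ z zP); apply/andP; split.
Qed.

Fact covers_maximum (P : finPoset) (t : P) (u : remove_max P) : is_maximum t ->
  covers (val u) t = is_maximal u.
Proof.
move=> tm; rewrite /covers /is_maximal.
have -> : val u < t.
  by rewrite lt_neqAle -(is_maximumE tm) (valP u) /=; move/forallP: tm => /(_ (val u)).
congr (~~ _); apply/existsP/existsP => [[z /andP[h1 h2]]|[z h]].
  have zP : ~~ is_maximum z by rewrite (is_maximumE tm); apply: (contraTneq _ h2) => ->; rewrite ltxx.
  by exists (exist _ z zP).
exists (val z); apply/andP; split; first exact: h.
by rewrite lt_neqAle -(is_maximumE tm) (valP z) /=; move/forallP: tm => /(_ (val z)).
Qed.

Fact num_covers_remove_max (P : finPoset) (t : P) : is_maximum t ->
  (num_covers P = num_covers (remove_max P) + \sum_(u : remove_max P) is_maximal u)%N.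
Proof.
move=> tm; rewrite {1}/num_covers -(sum_remove_max _ tm) [X in (_ + X)%N]big1 ?addn0; last first.
  move=> y _; rewrite /covers; case: (boolP (t < y)) => //= h.
  by have := lt_le_trans h (forallP tm y); rewrite ltxx.
rewrite /num_covers -big_split /=; apply: eq_bigr => u _.
rewrite -(sum_remove_max _ tm) (covers_maximum _ tm); congr (_ + _)%N.
by apply: eq_bigr => v _; rewrite (covers_remove_max _ _ tm).
Qed.

Fact num_covers_osum (P Q : finPoset) :
  (num_covers (osum P Q) = num_covers P +
    (\sum_(u : P) is_maximal u) * (\sum_(v : Q) is_minimal v) +
    num_covers Q)%N.
Proof.
rewrite /num_covers big_sumType /=; congr (_ + _)%N.
  rewrite big_distrl -big_split /=; apply: eq_bigr => u _.
  rewrite big_sumType /=; congr (_ + _)%N.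
    by apply: eq_bigr => v _; rewrite covers_osum_ll.
  by rewrite big_distrr; apply: eq_bigr => v _; rewrite covers_osum_lr -mulnb.
apply: eq_bigr => u _; rewrite big_sumType /= [X in (X + _)%N]big1 ?add0n.
  by apply: eq_bigr => v _; rewrite covers_osum_rr.
  by [].
Qed.

Fact lt_diamond1E (x y : diamond1) : (x < y) = (x != y) && le_diamond1 x y.
Proof. by rewrite lt_neqAle. Qed.

Fact covers_diamond1E (x y : diamond1) : covers x y =
  ((val x, val y) \in [:: (0,1);(0,2);(1,3);(2,3)]%N).
Proof.
apply/idP/idP.
  rewrite /covers lt_diamond1E => /andP[h /existsPn hz].
  have := hz (inord 1); rewrite !lt_diamond1E; move: h.
  case: x y {hz} => [[|[|[|[|x]]]] xP] [[|[|[|[|y]]]] yP] //=.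
  by rewrite /le_diamond1 -!val_eqE /= inordK.
move=> h; rewrite /covers lt_diamond1E; apply/andP; split.
  by move: h; case: x y => [[|[|[|[|x]]]] xP] [[|[|[|[|y]]]] yP].
apply/existsPn => z; move: h; rewrite !lt_diamond1E.
case: x y z => [[|[|[|[|x]]]] xP] [[|[|[|[|y]]]] yP] [[|[|[|[|z]]]] zP] //=.
Qed.

Fact minimal_diamond1E (x : diamond1) : is_minimal x = (val x == 0)%N.
Proof.
rewrite /is_minimal; apply/existsPn/eqP => [/(_ ord0)|h y].
  by rewrite lt_diamond1E /le_diamond1 /= orbT andbT negbK => /eqP <-.
by rewrite lt_diamond1E /le_diamond1; case: x y h => [[|[|[|[|x]]]] xP] [[|[|[|[|y]]]] yP].
Qed.

Fact num_covers_diamond1 : num_covers diamond1 = 4.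
Proof.
rewrite /num_covers; under eq_bigr => x _ do under eq_bigr => y _ do rewrite covers_diamond1E.
by rewrite !big_ord_recl !big_ord0.
Qed.
Fact num_min_diamond1 : (\sum_(v : diamond1) is_minimal v = 1)%N.
Proof.
by under eq_bigr => x _ do rewrite minimal_diamond1E; rewrite !big_ord_recl !big_ord0.
Qed.

Fact card_hasse_edge_diamond n : #|{: hasse_edge (diamond n.+1)}| = (4 * n.+1)%N.
Proof.
rewrite card_hasse_edge; elim: n => [|n IH]; first exact: num_covers_diamond1.
have [t tm] := diamond_has_maximum n.+1.
rewrite [diamond n.+2]/= num_covers_osum -/(diamond n.+1) num_min_diamond1 muln1.
rewrite -(num_covers_remove_max tm) IH num_covers_diamond1 mulnS.
by rewrite [RHS]mulnS addnC mulnS.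
Qed.

Fact card_diamond n : #|diamond n.+1| = (3 * n.+1 + 1)%N.
Proof.
elim: n => [|n IH]; first exact: card_ord.
have [t tm] := diamond_has_maximum n.+1.
have := sum_remove_max (fun=> 1%N) tm; rewrite !sum1_card IH => h.
rewrite [diamond n.+2]/= [LHS]card_sum -/(diamond n.+1) card_ord.
move: h; rewrite [3 * n.+2]mulnS => h.
have -> : (3 + 3 * n.+1 + 1 = (3 * n.+1 + 1) + 3)%N by rewrite -addnA addnC.
by rewrite -h -addnA.
Qed.

Local Close Scope order_scope.
Local Open Scope ring_scope.

Section IdealQuotient.
Variables (R : comNzRingType) (G : R -> Prop).

Definition ideal_gen : {pred R^o} := fun f => `[<
  exists2 s : seq (R * R), {in s, forall p, G p.2} &
                           f = \sum_(p <- s) p.1 * p.2 >].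

Fact ideal_gen_submod_closed : GRing.submod_closed ideal_gen.
Proof.
split=> [|a f g /asboolP[s sG ->] /asboolP[t tG ->]].
  by apply/asboolP; exists [::]; rewrite ?big_nil.
apply/asboolP; exists ([seq (a * p.1, p.2) | p <- s] ++ t).
  by move=> p; rewrite mem_cat => /orP[/mapP[q /sG qG ->]|/tG].
rewrite big_cat big_map /=; congr (_ + _).
by rewrite /GRing.scale /= mulr_sumr; apply: eq_bigr => p _; rewrite mulrA.
Qed.
HB.instance Definition _ :=
  GRing.isSubmodClosed.Build R R^o ideal_gen ideal_gen_submod_closed.

Definition quot_ideal := {ideal_quot ideal_gen}.
HB.instance Definition _ := GRing.Zmodule.on quot_ideal.

Definition quot_pi (f : R) : quot_ideal := \pi_{ideal_quot ideal_gen}%qT f.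
Definition quot_repr (x : quot_ideal) : R := repr (x : {ideal_quot ideal_gen}).
Definition scale_quot (a : R) (x : quot_ideal) : quot_ideal :=
  quot_pi (a * quot_repr x).

Fact quot_reprK : cancel quot_repr quot_pi.
Proof. exact: reprK. Qed.

Fact quot_pi_eq (f g : R) : (quot_pi f == quot_pi g) = (f - g \in ideal_gen).
Proof. by rewrite (Quotient.idealrBE ideal_gen f g). Qed.

Fact quot_piD : {morph quot_pi : f g / f + g}.
Proof. by move=> f g; exact: (raddfD \pi_{ideal_quot ideal_gen}%qT). Qed.

Fact scale_quot_pi a f : scale_quot a (quot_pi f) = quot_pi (a * f).
Proof.
apply/eqP; rewrite quot_pi_eq -mulrBr.
by apply: (rpredZ a); rewrite -quot_pi_eq quot_reprK.
Qed.

Fact scale_quotA a b x : scale_quot a (scale_quot b x) = scale_quot (a * b) x.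
Proof. by rewrite -[x]quot_reprK !scale_quot_pi mulrA. Qed.

Fact scale_quot1 : left_id 1 scale_quot.
Proof. by move=> x; rewrite -[x]quot_reprK scale_quot_pi mul1r. Qed.

Fact scale_quotDr : right_distributive scale_quot +%R.
Proof.
move=> a x y; rewrite -[x]quot_reprK -[y]quot_reprK -quot_piD !scale_quot_pi.
by rewrite mulrDr quot_piD.
Qed.

Fact scale_quotDl x : {morph scale_quot^~ x : a b / a + b}.
Proof.
by move=> a b; rewrite -[x]quot_reprK !scale_quot_pi mulrDl quot_piD.
Qed.

HB.instance Definition _ := GRing.Zmodule_isLmodule.Build R quot_ideal
  scale_quotA scale_quot1 scale_quotDr scale_quotDl.
End IdealQuotient.

Definition projective (R : nzRingType) (P : lmodType R) : Prop :=
  forall (M N : lmodType R) (g : {linear M -> N}) (f : {linear P -> N}),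
    (forall y, exists x, g x = y) ->
    exists h : {linear P -> M}, forall x, g (h x) = f x.

(* A projective resolution  ... -> P 1 -> P 0 -> M -> 0  by the maps        *)
(* res_diff i : P (i + 1) -> P i and res_aug : P 0 -> M.                    *)
Record projective_resolution (R : nzRingType) (M : lmodType R) := {
  res_mod : nat -> lmodType R;
  res_diff : forall i, {linear res_mod i.+1 -> res_mod i};
  res_aug : {linear res_mod 0%N -> M};
  res_projective : forall i, projective (res_mod i);
  res_aug_surj : forall y, exists x, res_aug x = y;
  res_exact0 : forall x, res_aug x = 0 <-> exists y, x = res_diff 0%N y;
  res_exactS : forall i x,
    res_diff i x = 0 <-> exists y, x = res_diff i.+1 y
}.

Definition has_pd_le (R : nzRingType) (M : lmodType R) (p : nat) : Prop :=
  exists F : projective_resolution M,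
    forall i, (p < i)%N -> forall x : res_mod F i, x = 0.

Definition is_pd (R : nzRingType) (M : lmodType R) (p : nat) : Prop :=
  has_pd_le M p /\ forall q, has_pd_le M q -> (p <= q)%N.

Section Regularity.
Variables (k : fieldType) (m : nat).
Local Notation S := {mpoly k[m]}.

Definition poly_homog (z : int) (f : S) : Prop :=
  match z with
  | Posz e => f \is e.-homog
  | Negz _ => f = 0
  end.

(* The degree z part of S/(G); (G) is meant to be homogeneous. *)
Definition quot_homog (G : S -> Prop) (z : int) (x : quot_ideal G) : Prop :=
  exists2 f, poly_homog z f & x = quot_pi G f.

(* A graded free resolution of M, graded by the sets gr z (z : int): the     *)
(* i-th module is the direct sum of the S(- gfr_deg a), a : 'I_(gfr_rank i), *)
(* its elements are row vectors, the matrices act on the right, and gfr_aug  *)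
(* gives the images in M of the basis elements of the 0-th module.          *)
Record graded_free_resolution (M : lmodType S) (gr : int -> M -> Prop) := {
  gfr_rank : nat -> nat;
  gfr_deg : forall i, 'I_(gfr_rank i) -> int;
  gfr_diff : forall i, 'M[S]_(gfr_rank i.+1, gfr_rank i);
  gfr_aug : 'I_(gfr_rank 0) -> M;
  gfr_diff_homog : forall i a b,
    poly_homog (gfr_deg a - gfr_deg b) (gfr_diff i a b);
  gfr_aug_homog : forall a, gr (gfr_deg a) (gfr_aug a);
  gfr_aug_surj : forall y,
    exists v : 'rV[S]_(gfr_rank 0), y = \sum_a v 0 a *: gfr_aug a;
  gfr_exact0 : forall v : 'rV[S]_(gfr_rank 0),
    \sum_a v 0 a *: gfr_aug a = 0 <-> exists w, v = w *m gfr_diff 0;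
  gfr_exactS : forall i (v : 'rV[S]_(gfr_rank i.+1)),
    v *m gfr_diff i = 0 <-> exists w, v = w *m gfr_diff i.+1
}.

(* The entries of the differentials lie in (x_1, ..., x_m). *)
Definition minimal_resolution (M : lmodType S) (gr : int -> M -> Prop)
    (F : graded_free_resolution gr) : Prop :=
  forall i a b, (gfr_diff F i a b)@_0%MM = 0.

(* reg M = max {j - i : beta_{i,j}(M) <> 0}, where beta_{i,j}(M) is the      *)
(* number of a : 'I_(gfr_rank i) of degree j in the minimal graded free     *)
(* resolution of M, which is unique up to isomorphism.                      *)
Definition is_reg (M : lmodType S) (gr : int -> M -> Prop) (r : int) : Prop :=
  exists F : graded_free_resolution gr,
  [/\ minimal_resolution F,
      exists i (a : 'I_(gfr_rank F i)), gfr_deg a - i%:Z = r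
    & forall i (a : 'I_(gfr_rank F i)), (gfr_deg a - i%:Z <= r)%R].
End Regularity.
Arguments quot_homog {k m} G z x.

Section Depth.
Variables (R : comNzRingType) (M : lmodType R).

(* x belongs to (s_0, ..., s_{l-1}) M. *)
Definition in_ideal_mul (s : seq R) (x : M) : Prop :=
  exists c : 'I_(size s) -> M, x = \sum_(j < size s) s`_j *: c j.

Definition regular_sequence (s : seq R) : Prop :=
  (forall (i : nat) (x : M), (i < size s)%N ->
     in_ideal_mul (take i s) (s`_i *: x) -> in_ideal_mul (take i s) x) /\
  exists x, ~ in_ideal_mul s x.

Definition is_depth (I : R -> Prop) (d : nat) : Prop :=
  (exists s, [/\ {in s, forall f, I f}, regular_sequence s & size s = d]) /\
  forall s, {in s, forall f, I f} -> regular_sequence s -> (size s <= d)%N.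
End Depth.

Definition graded_max_ideal {k : fieldType} {m : nat} (f : {mpoly k[m]}) : Prop :=
  f@_0%MM = 0.

Section Ideals.
Variables (k : fieldType) (P : finPoset) (m : nat).

Definition LD_gens (y : hasse_edge P -> 'I_m) (f : {mpoly k[m]}) : Prop :=
  exists2 s, maximal_saturated_chain s &
             f = \prod_(e : hasse_edge P | edge_of_chain s e) 'X_(y e).

Definition path_gens (t : nat) (x : P -> 'I_m) (f : {mpoly k[m]}) : Prop :=
  exists s, [/\ saturated_chain s, size s = t & f = \prod_(v <- s) 'X_(x v)].
End Ideals.
Arguments LD_gens k {P m} y f.
Arguments path_gens k {P m} t x f.

(* Main.v *)
From HB Require Import structures.
Require Import Defs.
From mathcomp Require Import all_boot all_order all_algebra.
From mathcomp Require Import boolp mpoly.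
From mathcomp Require Import zify.

(** Let [v_0 < {a_1, b_1} < v_1 < ... < {a_n, b_n} < v_n] be the elements of
    the n-th diamond poset.  A maximal chain is a choice of [a_i] or [b_i] for
    every [i], so both ideals have the form [u * \prod_i (p_i, q_i)] for
    monomials [u], [p_i], [q_i] in disjoint sets of variables: the [p_i], [q_i]
    have degree 2 and [u = 1] for the edges, they are variables and
    [u = v_0 ... v_n] for the elements.

    If [(p, q)] is a regular sequence and [q] is regular modulo [J], then
    [0 -> J -> J + J -> (p, q) J -> 0] is exact, and the mapping cone of two
    copies of a minimal resolution of [J] resolves [(p, q) J] minimally;
    iteration gives the resolution of length [n + 1] and its degrees.  A
    shorter projective resolution is excluded by comparison: the identity of
    the minimal resolution would be homotopic to 0 in the top degree, whereas
    the differentials vanish modulo the maximal ideal.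

    For the depth, differences of variables form an explicit regular sequence,
    modulo which the quotient becomes that of a monomial ideal with a nonzero
    socle.  Koszul homology with respect to all variables shows that no regular
    sequence is longer: a nonzero class of degree [i] modulo [U] yields one of
    degree [i + 1] modulo [U + (f)] if [f] is regular modulo [U], and
    conversely one of degree [i] or [i - 1] is recovered from [U + (f)]; the
    socle is the top homology. *)

Set Implicit Arguments.
Unset Strict Implicit.
Unset Printing Implicit Defensive.

Import Order.TTheory GRing.Theory Num.Theory.

(** * Saturated chains of the diamond posets *)

(** The constants arise as follows. Let [e] be the common degree of the [p_i] and [q_i]. The largest
    difference of degree and homological degree starts at the degree of [u], grows by [2 e - 1] with
    each cone, and drops by 1 on passing from the ideal to the quotient: [3 n - 1] for the edges,
    [(n + 1) + n - 1] for the elements. For the depth, the edges use [2 n] differences, each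
    identifying the two edges at a middle element, and [n - 1] more that glue one variable of each
    factor to that of the first; for the elements, [2 n + 1] variables are glued into one.
    Differences of variables keep a monomial ideal monomial, so regularity and socle are read off
    exponents, over every field, finite or not. The upper bound on the depth must deal with
    arbitrary elements of the maximal ideal, homogeneous or not; each of them acts on the Koszul
    complex of the variables as a map homotopic to 0. The lower bound on the projective dimension
    likewise concerns arbitrary projective modules, hence the comparison of resolutions. *)

(* The minimum of the [i]-th diamond (counted from 0) has code [3 i], its two
   incomparable elements [3 i + 1] and [3 i + 2], its maximum [3 i + 3]. *)
Fixpoint dcode n : diamond n -> nat :=
  match n return diamond n -> nat with
  | 0 => fun d : diamond1 => val d
  | n'.+1 =>
    match n' return (diamond n' -> nat) -> diamond n'.+1 -> nat with
    | 0 => fun _ (d : diamond1) => val d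
    | n''.+1 => fun rec (u : osum (remove_max (diamond n''.+1)) diamond1) =>
        match u with
        | inl v => rec (val v)
        | inr d => 3 * n''.+1 + val d
        end
    end (@dcode n')
  end.

Definition ccovers (c d : nat) : bool :=
  match c %% 3 with
  | 0 => (d == c.+1) || (d == c.+2)
  | 1 => d == c.+2
  | _ => d == c.+1
  end.

Definition crank (c : nat) : nat := 2 * (c %/ 3) + (c %% 3 != 0).

Lemma code_cases c : exists i, [\/ c = 3 * i, c = 3 * i + 1 | c = 3 * i + 2].
Proof.
exists (c %/ 3); have := divn_eq c 3; have := ltn_pmod c (isT : 0 < 3).
by case: (c %% 3) => [|[|[|r]]] // _ e; [constructor 1 | constructor 2 | constructor 3]; lia.
Qed.

Lemma ccovers0 i d : ccovers (3 * i) d = (d == 3 * i + 1) || (d == 3 * i + 2).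
Proof. by rewrite /ccovers modnMr addn1 addn2. Qed.

Lemma ccovers1 i d : ccovers (3 * i + 1) d = (d == 3 * i.+1).
Proof. by rewrite /ccovers mulnC modnMDl mulnC; congr (_ == _); lia. Qed.

Lemma ccovers2 i d : ccovers (3 * i + 2) d = (d == 3 * i.+1).
Proof. by rewrite /ccovers [3 * i]mulnC modnMDl /=; congr (_ == _); lia. Qed.

Definition ccoversE := (ccovers0, ccovers1, ccovers2).

Lemma crank0 i : crank (3 * i) = 2 * i.
Proof. by rewrite /crank modnMr mulKn ?addn0. Qed.

Lemma crank1 i : crank (3 * i + 1) = 2 * i + 1.
Proof. by rewrite /crank [3 * i]mulnC modnMDl divnMDl // addn0. Qed.

Lemma crank2 i : crank (3 * i + 2) = 2 * i + 1.
Proof. by rewrite /crank [3 * i]mulnC modnMDl divnMDl // addn0. Qed.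

Definition crankE := (crank0, crank1, crank2).

Lemma ccovers_crank c d : ccovers c d -> crank d = (crank c).+1.
Proof.
have [i [] ->] := code_cases c; rewrite ccoversE.
- by move=> /orP[]/eqP->; rewrite !crankE addn1.
- by move=> /eqP->; rewrite !crankE; lia.
- by move=> /eqP->; rewrite !crankE; lia.
Qed.

Lemma ccovers_lt c d : ccovers c d -> c < d.
Proof.
have [i [] ->] := code_cases c; rewrite ccoversE; last 2 first.
- by move=> /eqP->; lia.
- by move=> /eqP->; lia.
- by move=> /orP[]/eqP->; lia.
Qed.

Lemma dcode_inl n (v : remove_max (diamond n.+1)) :
  @dcode n.+2 (inl v) = @dcode n.+1 (val v).
Proof. by []. Qed.

Lemma dcode_inr n (d : diamond1) : @dcode n.+2 (inr d) = 3 * n.+1 + val d.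
Proof. by []. Qed.

(** The four properties are proved together because the ordinal sum needs all of them for its lower
    part. The removed maximum and the minimum of the new diamond have the same code [3 * n.+1], so a
    covering across the sum has the codes of a covering of the old maximum. *)
Lemma dcode_props n :
  [/\ injective (@dcode n.+1), forall x, @dcode n.+1 x < 3 * n.+1 + 1,
      forall t : diamond n.+1, is_maximum t -> dcode t = 3 * n.+1 &
      forall x y : diamond n.+1, covers x y = ccovers (dcode x) (dcode y)].
Proof.
elim: n => [|n [injn ltn maxn covn]].
  split=> [|x|t tm|x y].
  - exact: val_inj.
  - exact: (ltn_ord x).
  - have := forallP tm (Ordinal (isT : 3 < 4)); rewrite /Order.le /= /le_diamond1.
    by case: t {tm} => [[|[|[|[|t]]]] lt_t].
  - rewrite (@covers_diamond1E x y) /=.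
    by case: x y => [[|[|[|[|x]]]] xP] [[|[|[|[|y]]]] yP].
have [t tm] := diamond_has_maximum n.+1.
have tE := maxn t tm.
have lt_inl (v : remove_max (diamond n.+1)) : dcode (val v) < 3 * n.+1.
  have := ltn (val v); have : dcode (val v) != 3 * n.+1; last by lia.
  by apply: contra (valP v); rewrite -tE => /eqP /injn ->.
split.
- move=> [v|d] [v'|d']; rewrite ?dcode_inl ?dcode_inr.
  + by move=> /injn /val_inj ->.
  + by move=> e; exfalso; have := lt_inl v; rewrite e; lia.
  + by move=> e; exfalso; have := lt_inl v'; rewrite -e; lia.
  + by move=> /addnI /val_inj ->.
- move=> [v|d]; rewrite ?dcode_inl ?dcode_inr; first by have := lt_inl v; lia.
  by have : val d < 4 := ltn_ord d; lia.
- move=> s sm; pose top : diamond n.+2 := inr (Ordinal (isT : 3 < 4)).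
  have := forallP sm top; case: {sm} s => [v|d] //=.
  rewrite osum_leE /= /Order.le /= /le_diamond1.
  by case: d => [[|[|[|[|d]]]] ltd] //= _; lia.
- move=> [v|d] [v'|d']; rewrite ?dcode_inl ?dcode_inr.
  + by rewrite covers_osum_ll (covers_remove_max _ _ tm) covn.
  + rewrite covers_osum_lr -(covers_maximum _ tm) covn tE minimal_diamond1E.
    have := lt_inl v; move: (@dcode n.+1 (val v)) => c.
    have [i [] ->] := code_cases c; rewrite !ccoversE; lia.
  + rewrite covers_osum_rl; apply/esym/negbTE/negP => /ccovers_lt.
    by have := lt_inl v'; lia.
  + rewrite covers_osum_rr covers_diamond1E.
    have c3 a b : ccovers (3 * n.+1 + a) (3 * n.+1 + b) = ccovers a b.
      rewrite /ccovers mulnC modnMDl; case: (a %% 3) => [|[|r]];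
      by rewrite -!addnS !eqn_add2l.
    rewrite c3; by case: d d' => [[|[|[|[|d]]]] dP] [[|[|[|[|d']]]] dP'].
Qed.

(* The code of the element of rank [j] of the maximal chain that passes
   through [3 i + 1] or [3 i + 2] according to [eps i]. *)
Definition chain_code (eps : nat -> bool) j : nat :=
  if odd j then (if eps j./2 then 3 * j./2 + 2 else 3 * j./2 + 1) else 3 * j./2.

Lemma chain_code_even eps i : chain_code eps (2 * i) = 3 * i.
Proof. by rewrite /chain_code mul2n odd_double doubleK. Qed.

Lemma chain_code_odd eps i : chain_code eps (2 * i + 1) = if eps i then 3 * i + 2 else 3 * i + 1.
Proof. by rewrite /chain_code mul2n addn1 /= odd_double uphalf_double. Qed.

Lemma parity_cases j : exists i, j = 2 * i \/ j = 2 * i + 1.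
Proof. by exists j./2; have := odd_double_half j; case: odd; lia. Qed.

Lemma chain_code_lt n eps j : j < 2 * n + 1 -> chain_code eps j < 3 * n + 1.
Proof.
have [i [] ->] := parity_cases j; rewrite ?chain_code_even ?chain_code_odd; first lia.
by case: (eps i) => /=; lia.
Qed.

Lemma chain_code_covers eps j : ccovers (chain_code eps j) (chain_code eps j.+1).
Proof.
have [i [] ->] := parity_cases j.
  rewrite -[(2 * i).+1]addn1 chain_code_even chain_code_odd ccovers0.
  by case: (eps i); rewrite eqxx ?orbT.
have -> : (2 * i + 1).+1 = 2 * i.+1 by lia.
by rewrite chain_code_even chain_code_odd; case: (eps i); rewrite ccoversE eqxx.
Qed.

Lemma crank_chain_code eps j : crank (chain_code eps j) = j.
Proof.
have [i [] ->] := parity_cases j; first by rewrite chain_code_even crank0.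
by rewrite chain_code_odd; case: (eps i); rewrite crankE.
Qed.

Lemma crank_le n c : c < 3 * n + 1 -> crank c <= 2 * n.
Proof. by have [i [] ->] := code_cases c; rewrite crankE; lia. Qed.

Section DiamondChains.
Variables (n : nat) (n_gt0 : 0 < n).
Local Notation P := (diamond n).

Lemma dcode_inj : injective (@dcode n).
Proof. by case: n n_gt0 => // n' _; case: (dcode_props n'). Qed.

Lemma dcode_lt (x : P) : dcode x < 3 * n + 1.
Proof. by case: n n_gt0 x => // n' _ x; case: (dcode_props n'). Qed.

Lemma dcode_covers (x y : P) : covers x y = ccovers (dcode x) (dcode y).
Proof. by case: n n_gt0 x y => // n' _ x y; case: (dcode_props n'). Qed.

Lemma dcode_surj c : c < 3 * n + 1 -> exists x : P, dcode x = c.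
Proof.
move=> lt_c; pose f (x : P) : 'I_(3 * n + 1) := Ordinal (dcode_lt x).
have injf : injective f by move=> x y /(congr1 val) /dcode_inj.
have cardP : #|P| = #|'I_(3 * n + 1)|.
  by rewrite card_ord; case: n n_gt0 => // n' _; apply: card_diamond.
have [g _ gK] := inj_card_bij injf (eq_leq (esym cardP)).
by exists (g (Ordinal lt_c)); have /(congr1 val) := gK (Ordinal lt_c).
Qed.

Lemma dcode_inv : exists el : nat -> P, forall c, c < 3 * n + 1 -> dcode (el c) = c.
Proof.
have [|x0 _] := @dcode_surj 0; first by lia.
pose el c := if [pick x : P | dcode x == c] is Some x then x else x0.
exists el => c lt_c; rewrite /el; case: pickP => [x /eqP // | nx].
by have [x xc] := dcode_surj lt_c; have := nx x; rewrite xc eqxx.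
Qed.

Variables (x0 : P).

Lemma saturated_crank (s : seq P) i : saturated_chain s -> i < size s ->
  crank (dcode (nth x0 s i)) = crank (dcode (nth x0 s 0)) + i.
Proof.
move=> /(sortedP x0) ss; elim: i => [|i IH] lt_i; first by rewrite addn0.
have := ss i lt_i; rewrite dcode_covers => /ccovers_crank ->.
by rewrite IH ?addnS //; lia.
Qed.

Lemma saturated_uniq (s : seq P) : saturated_chain s -> uniq s.
Proof.
move=> ss; apply/(uniqP x0) => i j lt_i lt_j eqij.
by have := saturated_crank ss lt_i; rewrite eqij (saturated_crank ss lt_j) => /addnI.
Qed.

Lemma saturated_size (s : seq P) : saturated_chain s ->
  crank (dcode (nth x0 s 0)) + size s <= 2 * n + 1.
Proof.
move=> ss; have le0 := crank_le (dcode_lt (nth x0 s 0)).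
have [s0 | s0] := posnP (size s); first by rewrite s0; lia.
have := crank_le (dcode_lt (nth x0 s (size s).-1)).
by rewrite (saturated_crank ss) ?ltn_predL //; lia.
Qed.

(** Coverings raise the rank by one and ranks lie between 0 and [2 * n], which bounds the size. A
    chain that starts above rank 0 or ends below rank [2 * n] can be prolonged there; the added
    element has a rank outside the range of the chain, against maximality. *)
Lemma maximal_saturatedP (s : seq P) :
  maximal_saturated_chain s <-> saturated_chain s /\ size s = 2 * n + 1.
Proof.
split=> [[ss maxs] | [ss sz]]; last first.
  split=> // t st sub.
  have [|_ eqst] := uniq_min_size (saturated_uniq ss) sub.
    by rewrite sz; apply: leq_trans (saturated_size st); apply: leq_addl.
  by move=> z; rewrite -eqst.
split=> //; have [el elK] := dcode_inv.
have sz_gt0 : 0 < size s.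
  case: s ss maxs => // _ maxs; have sub : {subset [::] <= [:: el 0]} by [].
  by have := maxs [:: el 0] isT sub (el 0); rewrite mem_head => /(_ isT).
pose c := dcode (nth x0 s 0); pose d := dcode (nth x0 s (size s).-1).
have dE : crank d = crank c + (size s).-1.
  by apply: saturated_crank; rewrite // ltn_predL.
have rank_in z : z \in s -> crank c <= crank (dcode z) <= crank d.
  move=> /(nthP x0)[i lt_i <-]; rewrite dE (saturated_crank ss lt_i) leq_addr.
  by rewrite leq_add2l -ltnS prednK.
have c0 : crank c = 0.
  have [// | c0] := eqVneq (crank c) 0.
  have [b lt_b bc] : exists2 b, b < 3 * n + 1 & ccovers b c.
    have := dcode_lt (nth x0 s 0); rewrite -/c; move: c0.
    have [i [] ->] := code_cases c; rewrite crankE => c0 lt_c.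
    + case: i c0 lt_c => // i _ lt_c; exists (3 * i + 1); last by rewrite ccoversE.
      by lia.
    + by exists (3 * i); rewrite ?ccoversE ?eqxx //; lia.
    + by exists (3 * i); rewrite ?ccoversE ?eqxx ?orbT //; lia.
  have : saturated_chain (el b :: s).
    case: s ss @c @d {maxs sz_gt0 rank_in dE c0} bc => // z s ss c d bc; rewrite /saturated_chain /=.
    by rewrite dcode_covers elK // bc.
  move/maxs => /(_ (fun z zs => mem_behead (s := el b :: s) zs)) /(_ (el b) (mem_head _ _)).
  by move/rank_in; rewrite elK //; have := ccovers_crank bc; lia.
have d2 : crank d = 2 * n.
  have [// | d2] := eqVneq (crank d) (2 * n).
  have [b lt_b bd] : exists2 b, b < 3 * n + 1 & ccovers d b.
    have := dcode_lt (nth x0 s (size s).-1); rewrite -/d; move: d2.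
    have [i [] ->] := code_cases d; rewrite crankE => d2 lt_d.
    + by exists (3 * i + 1); rewrite ?ccoversE ?eqxx //; lia.
    + by exists (3 * i.+1); rewrite ?ccoversE ?eqxx //; lia.
    + by exists (3 * i.+1); rewrite ?ccoversE ?eqxx ?orbT //; lia.
  have : saturated_chain (rcons s (el b)).
    case: s ss @c @d {maxs sz_gt0 rank_in dE c0 d2} bd => // z s ss c d bd.
    rewrite /saturated_chain /= rcons_path; apply/andP; split; first exact: ss.
    by rewrite dcode_covers elK // (last_nth x0).
  have sub : {subset s <= rcons s (el b)} by move=> z zs; rewrite mem_rcons inE zs orbT.
  move/maxs => /(_ sub (el b)); rewrite mem_rcons mem_head => /(_ isT) /rank_in.
  by rewrite elK //; have := ccovers_crank bd; lia.
by move: d2; rewrite dE c0 add0n addn1 => <-; rewrite prednK.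
Qed.

(** In a chain of this size position and rank agree, which leaves one element for an even position
    and two for an odd one; [eps] records the choice. *)
Lemma full_chainP (el : nat -> P) (s : seq P) :
  (forall c, c < 3 * n + 1 -> dcode (el c) = c) ->
  (saturated_chain s /\ size s = 2 * n + 1 <->
   exists eps, s = mkseq (fun j => el (chain_code eps j)) (2 * n + 1)).
Proof.
move=> elK; split=> [[ss sz] | [eps ->]]; last first.
  rewrite size_mkseq; split=> //; apply/(sortedP x0) => i; rewrite size_mkseq => lt_i.
  rewrite dcode_covers !nth_mkseq ?elK ?chain_code_lt //; try lia.
  exact: chain_code_covers.
have rankE i : i < 2 * n + 1 -> crank (dcode (nth x0 s i)) = i.
  move=> lt_i; rewrite (saturated_crank ss) ?sz //.
  by have := saturated_size ss; rewrite sz; lia.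
exists (fun i => dcode (nth x0 s (2 * i + 1)) == 3 * i + 2).
apply: (@eq_from_nth _ x0); first by rewrite size_mkseq.
rewrite sz => j lt_j; rewrite nth_mkseq //; apply: dcode_inj.
rewrite elK ?chain_code_lt //; move: (rankE j lt_j).
have [i [] ji] := parity_cases j; rewrite ji ?chain_code_even ?chain_code_odd -?ji.
  have [i' [] ->] := code_cases (dcode (nth x0 s j)); rewrite crankE; lia.
have [i' [] ->] := code_cases (dcode (nth x0 s j)); rewrite crankE ji => ii; first by lia.
  have -> : i' = i by lia.
  by rewrite eqn_add2l.
have -> : i' = i by lia.
by rewrite eqxx.
Qed.

End DiamondChains.

Local Open Scope ring_scope.

(** * Ideals and monomial ideals *)

Section IdealPredicates.
Variable R : comNzRingType.
Implicit Types (U V : R -> Prop) (f g a : R) (s : seq R).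

Definition ideal_closed U :=
  [/\ U 0, forall f g, U f -> U g -> U (f + g) & forall a f, U f -> U (a * f)].

Lemma ideal_closed_sum U (I : Type) (r : seq I) (P : pred I) (F : I -> R) :
  ideal_closed U -> (forall i, P i -> U (F i)) -> U (\sum_(i <- r | P i) F i).
Proof. by move=> [U0 UD _]; apply: big_ind. Qed.

(** The ideal [U + (s)], with the same shape as [in_ideal_mul]: regular sequences on a quotient then
    become statements about ideals of the ring itself ([in_ideal_mulP]). *)
Definition ideal_add U s f : Prop :=
  exists c : 'I_(size s) -> R, U (f - \sum_(j < size s) s`_j * c j).

Lemma ideal_add_closed U s : ideal_closed U -> ideal_closed (ideal_add U s).
Proof.
move=> [U0 UD UM]; split.
- exists (fun=> 0); rewrite big1 ?subr0 // => i _; exact: mulr0.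
- move=> f g [c Uc] [d Ud]; exists (fun j => c j + d j).
  under eq_bigr do rewrite mulrDr.
  by rewrite big_split /= opprD addrACA; apply: UD.
- move=> a f [c Uc]; exists (fun j => a * c j).
  under eq_bigr do rewrite mulrCA.
  by rewrite -mulr_sumr -mulrBr; apply: UM.
Qed.

Lemma ideal_add_sub U s f : U f -> ideal_add U s f.
Proof.
move=> Uf; exists (fun=> 0); rewrite big1 ?subr0 // => i _; exact: mulr0.
Qed.

Lemma ideal_add_mem U s g : ideal_closed U -> g \in s -> ideal_add U s g.
Proof.
move=> [U0 _ _] /(nthP 0)[i lt_i <-]; exists (fun j : 'I__ => (i == j)%:R).
rewrite (bigD1 (Ordinal lt_i)) //= eqxx mulr1 big1 ?addr0 ?subrr // => j.
by rewrite -val_eqE /= eq_sym => /negPf ->; rewrite mulr0.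
Qed.

Lemma ideal_add_min U V s f : ideal_closed V ->
  (forall g, U g -> V g) -> {in s, forall g, V g} -> ideal_add U s f -> V f.
Proof.
move=> idV UV sV [c /UV Uc]; rewrite -(subrK (\sum_(j < size s) s`_j * c j) f).
case: (idV) => _ VD VM; apply: VD => //; apply: ideal_closed_sum => // j _.
by rewrite mulrC; apply: VM; apply: sV; apply: mem_nth.
Qed.

Lemma ideal_add_nil U f : ideal_closed U -> ideal_add U [::] f <-> U f.
Proof.
by move=> idU; split; [apply: ideal_add_min | apply: ideal_add_sub].
Qed.

Lemma ideal_add_rcons U s g f : ideal_closed U ->
  ideal_add U (rcons s g) f <-> exists h, ideal_add U s (f - g * h).
Proof.
move=> idU; split.
- apply: (@ideal_add_min U (fun f => exists h, ideal_add U s (f - g * h))).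
  + have [V0 VD VM] := ideal_add_closed s idU.
    split; first by exists 0; rewrite mulr0 subr0.
    * move=> x y [h Vx] [h' Vy]; exists (h + h').
      by rewrite mulrDr opprD addrACA; apply: VD.
    * by move=> a x [h Vx]; exists (a * h); rewrite mulrCA -mulrBr; apply: VM.
  + by move=> x Ux; exists 0; rewrite mulr0 subr0; apply: ideal_add_sub.
  + move=> x; rewrite mem_rcons inE => /orP[/eqP -> | sx].
      by exists 1; rewrite mulr1 subrr; case: (ideal_add_closed s idU).
    by exists 0; rewrite mulr0 subr0; apply: ideal_add_mem.
- move=> [h Vf]; have idV := ideal_add_closed (rcons s g) idU.
  rewrite -(subrK (g * h) f); case: (idV) => _ VD VM; apply: VD.
    apply: ideal_add_min Vf => // [x|x sx]; first exact: ideal_add_sub.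
    by apply: ideal_add_mem => //; rewrite mem_rcons inE sx orbT.
  rewrite mulrC; apply: VM; apply: ideal_add_mem => //.
  by rewrite mem_rcons mem_head.
Qed.

Lemma ideal_genP (G : R -> Prop) : ideal_closed (fun f => f \in ideal_gen G).
Proof.
split; first exact: rpred0.
- by move=> f g; apply: (@rpredD R^o (ideal_gen G)).
- by move=> a f; apply: (@rpredZ R R^o (ideal_gen G)).
Qed.

Lemma mem_ideal_gen (G : R -> Prop) g : G g -> g \in ideal_gen G.
Proof.
move=> Gg; apply/asboolP; exists [:: (1, g)]; last by rewrite big_seq1 mul1r.
by move=> p; rewrite inE => /eqP ->.
Qed.

Lemma ideal_gen_min (G V : R -> Prop) f : ideal_closed V ->
  (forall g, G g -> V g) -> f \in ideal_gen G -> V f.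
Proof.
move=> idV GV /asboolP[s sG ->]; rewrite big_seq; apply: ideal_closed_sum => //.
by move=> p /sG /GV Vp; case: idV => _ _; apply.
Qed.

Lemma in_ideal_mulP (G : R -> Prop) s f :
  in_ideal_mul s (quot_pi G f) <-> ideal_add (fun x => x \in ideal_gen G) s f.
Proof.
have piE (c : 'I_(size s) -> R) :
    \sum_(j < size s) s`_j *: quot_pi G (c j) = quot_pi G (\sum_(j < size s) s`_j * c j).
  transitivity (\sum_(j < size s) quot_pi G (s`_j * c j)).
    by apply: eq_bigr => j _; apply: scale_quot_pi.
  by rewrite (big_morph _ (@quot_piD _ G) (_ : quot_pi G 0 = 0)) //;
     apply: (raddf0 \pi_{ideal_quot ideal_gen G}%qT).
split=> [[c cE] | [c cE]].
- exists (fun j => quot_repr (c j)).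
  rewrite -quot_pi_eq; apply/eqP; rewrite cE -piE; apply: eq_bigr => j _.
  by rewrite quot_reprK.
- exists (fun j => quot_pi G (c j)); rewrite piE; apply/eqP.
  by rewrite quot_pi_eq.
Qed.

End IdealPredicates.

Section MonomialIdeals.
Variables (k : fieldType) (m : nat).
Local Notation S := {mpoly k[m]}.
Implicit Types (E F : 'X_{1..m} -> Prop) (u w p q : 'X_{1..m}) (f g h : S).

Definition up_closed E := forall u w, E u -> E (u + w)%MM.

(** Coding a monomial ideal by the set of its exponents turns divisibility, intersection and
    regularity into statements about exponents. *)
Definition monomial_ideal E f : Prop := forall u, f@_u != 0 -> E u.

Lemma monomial_ideal_closed E : up_closed E -> ideal_closed (monomial_ideal E).
Proof.
move=> upE; split=> [u | f g Ef Eg u | a f Ef u].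
- by rewrite mcoeff0 eqxx.
- rewrite mcoeffD; have [f0 | /Ef //] := eqVneq f@_u 0.
  by rewrite f0 add0r; apply: Eg.
- rewrite -mcoeff_msupp => /msuppM_le /allpairsP[[v w] /= [_ sw ->]].
  by rewrite addmC; apply: upE; apply: Ef; rewrite -mcoeff_msupp.
Qed.

Lemma monomial_idealX E u : monomial_ideal E 'X_[u] <-> E u.
Proof.
split=> [|Eu w]; first by apply; rewrite mcoeffX eqxx oner_neq0.
by rewrite mcoeffX; case: (u =P w) => [<- //|_]; rewrite eqxx.
Qed.

Lemma monomial_ideal_ind E (V : S -> Prop) f : ideal_closed V ->
  (forall u, E u -> V 'X_[u]) -> monomial_ideal E f -> V f.
Proof.
move=> idV EV Ef; rewrite [f]mpolyE big_seq; apply: ideal_closed_sum => // u.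
rewrite mcoeff_msupp => /Ef /EV Vu; rewrite -mul_mpolyC.
by case: idV => _ _; apply.
Qed.

Lemma eq_monomial_ideal E F f : (forall u, E u <-> F u) ->
  monomial_ideal E f <-> monomial_ideal F f.
Proof. by move=> EF; split=> H u /H /EF. Qed.

Lemma monomial_idealMX E p h :
  monomial_ideal E ('X_[p] * h) <-> monomial_ideal (fun u => E (u + p)%MM) h.
Proof.
rewrite mulrC; split=> H u; first by move=> hu; apply: H; rewrite addmC mcoeffMX.
rewrite -mcoeff_msupp => sp; move: (sp).
rewrite (perm_mem (msuppMX _ _)) => /mapP[v]; rewrite mcoeff_msupp => hv ->.
by rewrite addmC; apply: H.
Qed.

Lemma mpolyX_neq0 p : 'X_[p] != 0 :> S.
Proof. by rewrite -msupp_eq0 msuppX. Qed.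

Lemma mpolyX_dvd p f :
  monomial_ideal (fun u => (p <= u)%MM) f -> exists h, f = 'X_[p] * h.
Proof.
apply: (@monomial_ideal_ind _ (fun f => exists h, f = 'X_[p] * h)).
  split; first by exists 0; rewrite mulr0.
  - by move=> _ _ [a ->] [b ->]; exists (a + b); rewrite mulrDr.
  - by move=> a _ [b ->]; exists (a * b); rewrite mulrCA.
by move=> u /submK <-; exists 'X_[u - p]; rewrite addmC mpolyXD.
Qed.

Lemma monomial_ideal_gen (G : S -> Prop) E f : up_closed E ->
  (forall g, G g -> monomial_ideal E g) ->
  (forall u, E u -> exists2 w, G 'X_[w] & (w <= u)%MM) ->
  f \in ideal_gen G <-> monomial_ideal E f.
Proof.
move=> upE GE EG; split.
  by apply: ideal_gen_min => //; apply: monomial_ideal_closed.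
apply: (@monomial_ideal_ind _ (fun f => f \in ideal_gen G)); first exact: ideal_genP.
move=> u /EG[w Gw /submK <-]; rewrite mpolyXD.
by have [_ _ M] := ideal_genP G; apply: M; apply: mem_ideal_gen.
Qed.

Definition disjoint_mnm p q := forall i, p i = 0%N \/ q i = 0%N.

Lemma lem_disjoint p q u : disjoint_mnm p q ->
  (p <= u + q)%MM -> (p <= u)%MM.
Proof.
move=> dpq /mnm_lepP le; apply/mnm_lepP => i; have := le i; rewrite mnmDE.
by case: (dpq i) => ->; rewrite ?addn0.
Qed.

(** Only the Koszul relation exists: a monomial of ['X_[p] * f] occurs in ['X_[q] * g], hence is
    divisible by [q], and coprimality passes this on to [f]. *)
Lemma mpolyX_syzygy p q f g : disjoint_mnm p q ->
  'X_[p] * f + 'X_[q] * g = 0 -> exists2 h, f = 'X_[q] * h & g = - ('X_[p] * h).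
Proof.
move=> dpq eq0; have [u | h fE] := @mpolyX_dvd q f.
  move=> fu; apply: (@lem_disjoint q p); first by move=> i; case: (dpq i); auto.
  have: ('X_[p] * f)@_(u + p) != 0 by rewrite mulrC addmC mcoeffMX.
  rewrite -[_ * _](addrK ('X_[q] * g)) eq0 sub0r mcoeffN oppr_eq0 -mcoeff_msupp.
  by rewrite mulrC (perm_mem (msuppMX _ _)) => /mapP[v _ ->]; apply: lem_addr.
exists h => //; apply: (mulfI (mpolyX_neq0 q)).
by rewrite mulrN mulrCA -fE; apply/eqP; rewrite -addr_eq0 addrC eq0.
Qed.

(* Comparing coefficients at [u + U_(c)] moves a zero coefficient at [u] to
   [u + U_(c) - U_(d)], whose exponent of [d] is smaller. *)
Lemma monomial_ideal_nzd_free E c d f : up_closed E -> c != d ->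
  (forall u, E (u + U_(c))%MM -> E u) ->
  monomial_ideal E (('X_c - 'X_d) * f) -> monomial_ideal E f.
Proof.
move=> upE ncd Ec Ef u; have [n] := ubnP (u d).
elim: n u => // n IH u /ltnSE le_un fu.
case: (pselect (E u)) => // nEu; exfalso.
have nEuc : ~ E (u + U_(c))%MM by move/Ec.
have : (('X_c - 'X_d) * f)@_(u + U_(c)) = 0.
  by apply/eqP/negPn/negP => /Ef.
rewrite mulrBl mcoeffB mulrC addmC mcoeffMX mulrC.
have [/eqP -> | nz] := boolP ((f * 'X_d)@_(U_(c) + u) == 0).
  by move=> /eqP; rewrite subr0 (negPf fu).
have := nz; rewrite -mcoeff_msupp (perm_mem (msuppMX _ _)) => /mapP[v].
rewrite mcoeff_msupp => fv uv _.
have uvE i : (U_(c)%MM i + u i = U_(d)%MM i + v i)%N by rewrite -!mnmDE uv.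
have := uvE d; rewrite !mnm1E eqxx (negPf ncd) => uvd.
have /nEuc // : E (u + U_(c))%MM.
by rewrite addmC uv addmC; apply: upE; apply: IH => //; lia.
Qed.

(** Associated primes of monomial ideals are generated by variables; those of [E1] miss [X_c] and
    those of [E2] miss [X_d], so none contains the difference. The proof reaches each of [E1] and
    [E2] separately, with the roles of [c] and [d] exchanged. *)
Lemma monomial_ideal_nzd E E1 E2 c d f :
  up_closed E1 -> up_closed E2 -> c != d ->
  (forall u, E u <-> E1 u /\ E2 u) ->
  (forall u, E1 (u + U_(c))%MM -> E1 u) ->
  (forall u, E2 (u + U_(d))%MM -> E2 u) ->
  monomial_ideal E (('X_c - 'X_d) * f) -> monomial_ideal E f.
Proof.
move=> up1 up2 ncd EE Ec Ed Ef u fu; apply/EE; split.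
  apply: (monomial_ideal_nzd_free up1 ncd Ec) fu => w /Ef /EE[] //.
apply: (monomial_ideal_nzd_free up2 (c := d) (d := c)) fu => //; first by rewrite eq_sym.
move=> w; rewrite -opprB mulNr mcoeffN oppr_eq0 => /Ef /EE[] //.
Qed.

End MonomialIdeals.

(** * Minimal free resolutions by iterated mapping cones *)

Section IdealResolution.
Variables (k : fieldType) (m : nat).
Local Notation S := {mpoly k[m]}.

Lemma poly_homog0 z : poly_homog z (0 : S).
Proof. by case: z => // e; apply: dhomog0. Qed.

Lemma poly_homogN z (f : S) : poly_homog z f -> poly_homog z (- f).
Proof. by case: z => [e|e /= ->]; [rewrite /= rpredN | rewrite oppr0]. Qed.

Lemma poly_homogM e z (f g : S) :
  f \is e.-homog -> poly_homog z g -> poly_homog (z + e%:Z) (f * g).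
Proof.
case: z => [d|d] fh gh; first by rewrite -PoszD addnC; apply: dhomogM.
by rewrite gh mulr0; apply: poly_homog0.
Qed.

(* A minimal graded free resolution of the ideal [J], of length [L], with
   [r = max (degree - homological degree)]. *)
Record ideal_resolution (J : S -> Prop) (L : nat) (r : int) := {
  irk : nat -> nat;
  ideg : forall i, 'I_(irk i) -> int;
  idiff : forall i, 'M[S]_(irk i.+1, irk i);
  iaug : 'cV[S]_(irk 0);
  idiff_homog : forall i a b, poly_homog (ideg a - ideg b) (idiff i a b);
  iaug_homog : forall a, poly_homog (ideg a) (iaug a 0);
  idiff_min : forall i a b, (idiff i a b)@_0%MM = 0;
  iaug_im : forall f, J f <-> exists v : 'rV_(irk 0), f%:M = v *m iaug;
  iexact0 : forall v : 'rV_(irk 0),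
    v *m iaug = 0 <-> exists w, v = w *m idiff 0;
  iexactS : forall i (v : 'rV_(irk i.+1)),
    v *m idiff i = 0 <-> exists w, v = w *m idiff i.+1;
  irk_gt : forall i, (L < i)%N -> irk i = 0%N;
  irk_top : (0 < irk L)%N;
  ireg_le : forall i (a : 'I_(irk i)), ideg a - i%:Z <= r;
  ireg_eq : exists i (a : 'I_(irk i)), ideg a - i%:Z = r
}.

Section Principal.
Variables (f : S) (e : nat).
Hypotheses (f_neq0 : f != 0) (f_homog : f \is e.-homog).

Lemma principal_resolution :
  ideal_resolution (fun g => exists h, g = h * f) 0 e.
Proof.
pose rk i := (i == 0)%N : nat.
apply: (@Build_ideal_resolution _ _ _ rk (fun i _ => e%:Z) (fun i => 0)
  (const_mx f)).
- by move=> i a b; rewrite mxE; apply: poly_homog0.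
- by move=> a; rewrite mxE.
- by move=> i a b; rewrite mxE mcoeff0.
- move=> g; split=> [[h ->] | [v gE]].
    exists (const_mx h); apply/matrixP=> i j.
    by rewrite !mxE big_ord1 !mxE !ord1.
  exists (v 0 0); have /matrixP/(_ 0 0) := gE.
  by rewrite !mxE big_ord1 !mxE mulr1n.
- move=> v; split=> [v0 | [w ->]]; last by rewrite /= -?mulmxA ?mul0mx !mulmx0.
  exists 0; rewrite mulmx0; apply/matrixP=> i j; have /matrixP/(_ i 0) := v0.
  rewrite !mxE big_ord1 !mxE => /eqP.
  by rewrite mulf_eq0 (negPf f_neq0) orbF !ord1 => /eqP.
- move=> i v; split=> [_ | [w ->]]; last by rewrite /= -?mulmxA ?mul0mx !mulmx0.
  by exists 0; apply/matrixP => a [b].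
- by case.
- by [].
- by move=> [|i] [] // a lt_a; rewrite subr0.
- by exists 0%N, ord0; rewrite subr0.
Qed.
End Principal.

Section Cone.
Variables (J J' : S -> Prop) (L : nat) (r : int) (F : ideal_resolution J L r).
Variables (p q : S) (e : nat).
Hypotheses (e_gt0 : (0 < e)%N) (q_neq0 : q != 0).
Hypotheses (p_homog : p \is e.-homog) (q_homog : q \is e.-homog).
Hypotheses (p0 : p@_0%MM = 0) (q0 : q@_0%MM = 0).
Hypothesis J'E : forall f, J' f <-> exists g h, [/\ J g, J h & f = p * g + q * h].
Hypothesis syz : forall f g, J f -> J g -> p * f + q * g = 0 ->
  exists h, [/\ J h, f = q * h & g = - (p * h)].

(** Cone of the map [(q, - p)] from one copy of [F] to two copies; the last block is the shifted
    source. Its shift by [2 e] in [cone_deg] is the degree of the Koszul relation, against [e] for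
    [p] and [q]. *)
Definition cone_rk i :=
  if i is j.+1 then (irk F j.+1 + irk F j.+1 + irk F j)%N
  else (irk F 0 + irk F 0)%N.

Definition cone_deg i : 'I_(cone_rk i) -> int :=
  match i with
  | 0 => fun a => e%:Z + match split a with inl b | inr b => ideg b end
  | j.+1 => fun a => e%:Z + match split a with
      | inl b => match split b with inl c | inr c => ideg c end
      | inr b => e%:Z + ideg b end
  end.

Definition cone_diff i : 'M[S]_(cone_rk i.+1, cone_rk i) :=
  match i with
  | 0 => col_mx (block_mx (idiff F 0) 0 0 (idiff F 0)) (row_mx q%:M (- p%:M))
  | j.+1 => block_mx (block_mx (idiff F j.+1) 0 0 (idiff F j.+1)) 0
                     (row_mx q%:M (- p%:M)) (- idiff F j)
  end.

Definition cone_aug : 'cV[S]_(cone_rk 0) := col_mx (p *: iaug F) (q *: iaug F).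

Lemma scalar_homog (n : nat) (d : 'I_n -> int) (f : S) a b :
  f \is e.-homog -> poly_homog (e%:Z + d a - d b) ((f%:M : 'M_n) a b).
Proof.
rewrite mxE; case: eqP => [-> fh | _ _]; last exact: poly_homog0.
by rewrite addrK mulr1n.
Qed.

Let splitl n1 n2 (i : 'I_n1) : split (lshift n2 i) = inl i := unsplitK (inl i).
Let splitr n1 n2 (i : 'I_n2) : split (rshift n1 i) = inr i := unsplitK (inr i).
Let splitE := (splitl, splitr).
Let blockE := (col_mxEu, col_mxEd, row_mxEl, row_mxEr, block_mxEul, block_mxEur,
  block_mxEdl, block_mxEdr).

Lemma cone_diff_homog i a b :
  poly_homog (cone_deg a - cone_deg b) (cone_diff i a b).
Proof.
have subE (x y : int) : e%:Z + x - (e%:Z + y) = x - y by lia.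
have homogF j c d : poly_homog (ideg c - ideg d) (idiff F j c d) := idiff_homog _ _.
have h0 z : poly_homog z (0 : S) := poly_homog0 z.
have hs n (d : 'I_n -> int) (f : S) c c' : f \is e.-homog ->
  poly_homog (e%:Z + d c - d c') ((f%:M : 'M_n) c c') := @scalar_homog n d f c c'.
have hN (n n' : nat) (A : 'M[S]_(n, n')) z c c' :
    poly_homog z (A c c') -> poly_homog z ((- A) c c').
  by rewrite mxE; apply: poly_homogN.
case: i a b => [|i] a b.
- have [a' | a'] := split_ordP a => ->; have [b' | b'] := split_ordP b => ->;
  rewrite /= !splitE !subE /= ?blockE; last 2 first.
  + exact: hs.
  + by apply: hN; apply: hs.
  + have [c | c] := split_ordP a' => ->; rewrite ?splitE blockE ?mxE //.
  + have [c | c] := split_ordP a' => ->; rewrite ?splitE blockE ?mxE //.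
- have [a' | a'] := split_ordP a => ->; have [b' | b'] := split_ordP b => ->;
  rewrite /= !splitE !subE /= ?blockE; last first.
  + by apply: hN.
  + have [c | c] := split_ordP b' => ->; rewrite ?splitE blockE; first exact: hs.
    by apply: hN; apply: hs.
  + by rewrite mxE.
  + have [c | c] := split_ordP a' => ->; have [d | d] := split_ordP b' => ->;
    by rewrite ?splitE blockE ?mxE.
Qed.

Lemma cone_aug_homog a : poly_homog (cone_deg a) (cone_aug a 0).
Proof.
by have [b | b] := split_ordP a => ->; rewrite /= ?splitE blockE mxE addrC;
  apply: poly_homogM => //; apply: iaug_homog.
Qed.

Lemma cone_diff_min i a b : (cone_diff i a b)@_0%MM = 0.
Proof.
have c0 n c c' (f : S) : f@_0%MM = 0 -> ((f%:M : 'M_n) c c')@_0%MM = 0.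
  by move=> f0; rewrite mxE; case: eqP => _; rewrite ?f0 ?mcoeff0.
have hN (n n' : nat) (A : 'M[S]_(n, n')) c c' :
  (A c c')@_0%MM = 0 -> ((- A) c c')@_0%MM = 0 by rewrite mxE mcoeffN => ->; rewrite oppr0.
case: i a b => [|i] a b.
- have [a' | a'] := split_ordP a => ->; have [b' | b'] := split_ordP b => ->;
  rewrite /= ?blockE; last 2 first.
  + exact: c0.
  + by apply: hN; apply: c0.
  + by have [c | c] := split_ordP a' => ->; rewrite blockE ?mxE ?mcoeff0 ?idiff_min.
  + by have [c | c] := split_ordP a' => ->; rewrite blockE ?mxE ?mcoeff0 ?idiff_min.
- have [a' | a'] := split_ordP a => ->; have [b' | b'] := split_ordP b => ->;
  rewrite /= ?blockE; last first.
  + by apply: hN; apply: idiff_min.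
  + have [c | c] := split_ordP b' => ->; rewrite blockE; first exact: c0.
    by apply: hN; apply: c0.
  + by rewrite mxE mcoeff0.
  + by have [c | c] := split_ordP a' => ->; have [d | d] := split_ordP b' => ->;
    rewrite blockE ?mxE ?mcoeff0 ?idiff_min.
Qed.

Lemma mulmx_cone_diff0 n (g1 g2 : 'M_(n, irk F 1)) (h : 'M_(n, irk F 0)) :
  row_mx (row_mx g1 g2) h *m cone_diff 0 =
  row_mx (g1 *m idiff F 0 + q *: h) (g2 *m idiff F 0 - p *: h).
Proof.
rewrite /= mul_row_col mul_row_block mul_mx_row !mulmx0 addr0 add0r add_row_mx.
by rewrite mulmxN !mul_mx_scalar.
Qed.

Lemma mulmx_cone_diffS i n (g1 g2 : 'M_(n, irk F i.+2)) (h : 'M_(n, irk F i.+1)) :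
  row_mx (row_mx g1 g2) h *m cone_diff i.+1 =
  row_mx (row_mx (g1 *m idiff F i.+1 + q *: h) (g2 *m idiff F i.+1 - p *: h))
         (- (h *m idiff F i)).
Proof.
rewrite /= !mul_row_block mul_mx_row !mulmx0 addr0 !add0r add_row_mx.
by rewrite !mulmxN !mul_mx_scalar.
Qed.

Lemma mulmx_cone_aug n (g1 g2 : 'M_(n, irk F 0)) :
  row_mx g1 g2 *m cone_aug = p *: (g1 *m iaug F) + q *: (g2 *m iaug F).
Proof. by rewrite mul_row_col !scalemxAr. Qed.

Let mx11K (A : 'M[S]_1) : exists f, A = f%:M.
Proof. by exists (A 0 0); apply: mx11_scalar. Qed.

Let mx11I (f g : S) : f%:M = g%:M :> 'M_1 -> f = g.
Proof. by move/matrixP/(_ 0 0); rewrite !mxE !mulr1n. Qed.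

Let augJ (v : 'rV_(irk F 0)) : exists2 f, v *m iaug F = f%:M & J f.
Proof.
by have [f fE] := mx11K (v *m iaug F); exists f => //; apply/(iaug_im F); exists v.
Qed.

Lemma cone_aug_im f : J' f <-> exists v : 'rV_(cone_rk 0), f%:M = v *m cone_aug.
Proof.
split=> [/J'E[g [h [/(iaug_im F)[v vE] /(iaug_im F)[w wE] ->]]] | [v]].
  exists (row_mx v w); rewrite mulmx_cone_aug -vE -wE.
  by rewrite !scale_scalar_mx raddfD.
rewrite -[v]hsubmxK mulmx_cone_aug.
have [g -> Jg] := augJ (lsubmx v); have [h -> Jh] := augJ (rsubmx v).
by rewrite !scale_scalar_mx -raddfD => /mx11I ->; apply/J'E; exists g, h.
Qed.

Lemma cone_exact0 (v : 'rV_(cone_rk 0)) :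
  v *m cone_aug = 0 <-> exists w, v = w *m cone_diff 0.
Proof.
have d0 n (w : 'M_(n, _)) : w *m idiff F 0 *m iaug F = 0.
  apply/row_matrixP => i; rewrite row0 !row_mul.
  by apply/(@iexact0 _ _ _ F); exists (row i w).
split=> [| [w ->]]; last first.
  rewrite -[w]hsubmxK -[lsubmx w]hsubmxK mulmx_cone_diff0 mulmx_cone_aug.
  rewrite mulmxDl mulmxBl !d0 add0r sub0r -!scalemxAl scalerN !scalerA.
  by rewrite [q * p]mulrC subrr.
rewrite -[v]hsubmxK mulmx_cone_aug; set g1 := lsubmx v; set g2 := rsubmx v.
have [a aE Ja] := augJ g1; have [b bE Jb] := augJ g2.
rewrite aE bE !scale_scalar_mx -raddfD => ab0.
(* The relation is a multiple of the Koszul one; lifting its factor [c] to [h] and removing the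
   multiples of [h] leaves two cycles of [F]. *)
have /(syz Ja Jb)[c [/(iaug_im F)[h hE] ac bc]] : p * a + q * b = 0.
  by apply: mx11I; rewrite ab0 raddf0.
have /(@iexact0 _ _ _ F)[k1 k1E] : (g1 - q *: h) *m iaug F = 0.
  by rewrite mulmxBl -scalemxAl -hE aE ac scale_scalar_mx subrr.
have /(@iexact0 _ _ _ F)[k2 k2E] : (g2 + p *: h) *m iaug F = 0.
  by rewrite mulmxDl -scalemxAl -hE bE bc scale_scalar_mx -raddfD addNr raddf0.
exists (row_mx (row_mx k1 k2) h); rewrite mulmx_cone_diff0 -k1E -k2E.
by rewrite subrK addrK.
Qed.

Lemma cone_exactS i (v : 'rV_(cone_rk i.+1)) :
  v *m cone_diff i = 0 <-> exists w, v = w *m cone_diff i.+1.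
Proof.
have dS j n (w : 'M_(n, _)) : w *m idiff F j.+1 *m idiff F j = 0.
  apply/row_matrixP => a; rewrite row0 !row_mul.
  by apply/(@iexactS _ _ _ F); exists (row a w).
split=> [| [w ->]]; last first.
  rewrite -[w]hsubmxK -[lsubmx w]hsubmxK mulmx_cone_diffS.
  case: i v w => [|i] v w; rewrite ?mulmx_cone_diff0 ?mulmx_cone_diffS.
    rewrite mulmxDl mulmxBl !dS -!scalemxAl !scalerN !add0r !subrr.
    by rewrite row_mx0.
  rewrite mulmxDl mulmxBl mulNmx !dS -!scalemxAl !scalerN !add0r !subrr.
  by rewrite !oppr0 !row_mx0.
rewrite -[v]hsubmxK -[lsubmx v]hsubmxK.
set g1 := lsubmx _; set g2 := rsubmx (lsubmx v); set h := rsubmx v => v0.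
(* For [i > 0] the last block says that [h] is a cycle. For [i = 0] there is no such block, but
   [q *: h] is a boundary, so [q] kills the image of [h] in [J], which is 0 because [q != 0]. *)
have [u uE] : exists u, h = u *m idiff F i.
  case: i v @g1 @g2 @h v0 => [|i] v g1 g2 h.
    rewrite mulmx_cone_diff0 => /eqP; rewrite row_mx_eq0 => /andP[/eqP eq1 _].
    apply/(@iexact0 _ _ _ F).
    have: q *: (h *m iaug F) = 0.
      rewrite scalemxAl -[q *: h](addKr (g1 *m idiff F 0)) eq1 addr0 mulNmx.
      by apply/eqP; rewrite oppr_eq0; apply/eqP/(@iexact0 _ _ _ F); exists g1.
    have [c ->] := mx11K (h *m iaug F); rewrite scale_scalar_mx -[RHS](raddf0 (@scalar_mx S 1)).
    by move=> /mx11I/eqP; rewrite mulf_eq0 (negPf q_neq0) => /eqP ->; rewrite raddf0.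
  rewrite mulmx_cone_diffS => /eqP; rewrite row_mx_eq0 => /andP[_].
  by rewrite oppr_eq0 => /eqP /(@iexactS _ _ _ F).
have [eq1 eq2] : g1 *m idiff F i + q *: h = 0 /\ g2 *m idiff F i - p *: h = 0.
  case: i v g1 g2 h v0 {u uE} => [|i] v g1 g2 h.
    by rewrite mulmx_cone_diff0 => /eqP; rewrite row_mx_eq0 => /andP[/eqP ? /eqP ?].
  rewrite mulmx_cone_diffS => /eqP; rewrite !row_mx_eq0.
  by move=> /andP[/andP[/eqP ? /eqP ?] _].
have /(@iexactS _ _ _ F)[k1 k1E] : (g1 + q *: u) *m idiff F i = 0.
  by rewrite mulmxDl -scalemxAl -uE.
have /(@iexactS _ _ _ F)[k2 k2E] : (g2 - p *: u) *m idiff F i = 0.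
  by rewrite mulmxBl -scalemxAl -uE.
exists (row_mx (row_mx k1 k2) (- u)); rewrite mulmx_cone_diffS -k1E -k2E.
by rewrite !scalerN opprK addrK subrK mulNmx opprK uE.
Qed.

(** The last block gains [2 e] in degree and 1 in homological degree, the other two gain only [e],
    which is at most [2 e - 1] since [e > 0]. The last block therefore carries the maximum, and it
    also makes the top degree [L + 1] nonzero. *)
Lemma cone_resolution : ideal_resolution J' L.+1 (r + (2 * e)%N%:Z - 1).
Proof.
apply: (@Build_ideal_resolution _ _ _ cone_rk cone_deg cone_diff cone_aug).
- exact: cone_diff_homog.
- exact: cone_aug_homog.
- exact: cone_diff_min.
- exact: cone_aug_im.
- exact: cone_exact0.
- exact: cone_exactS.
- by move=> [|[|i]] // lt_i; rewrite /= !irk_gt //; lia.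
- by rewrite /= addn_gt0 irk_top orbT.
- move=> i a; case: i a => [|i] a; have [b | b] := split_ordP a => ->; rewrite /= ?splitE.
  + by have := ireg_le b; lia.
  + by have := ireg_le b; lia.
  + by have [c | c] := split_ordP b => _; rewrite ?splitE; have := ireg_le c; lia.
  + by have := ireg_le b; lia.
- have [i [a aE]] := ireg_eq F; exists i.+1, (rshift _ a).
  by rewrite /= ?splitE; move: aE; lia.
Qed.
End Cone.
End IdealResolution.

(** * Comparison of projective resolutions *)

Section Image.
Variables (R : nzRingType) (B C : lmodType R) (g : {linear B -> C}).

Definition image_pred : {pred C} := fun y => `[< exists x, y = g x >].

Fact image_submod_closed : GRing.submod_closed image_pred.
Proof.
split=> [|a _ _ /asboolP[x ->] /asboolP[y ->]]; apply/asboolP.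
  by exists 0; rewrite linear0.
by exists (a *: x + y); rewrite linearP.
Qed.
HB.instance Definition _ :=
  GRing.isSubmodClosed.Build R C image_pred image_submod_closed.

(** Projectivity is stated for surjections; with the image as codomain, [g] becomes one, and maps
    into its image can be lifted. *)
Definition image_mod := {y : C | y \in image_pred}.
HB.instance Definition _ := SubChoice.on image_mod.
HB.instance Definition _ := [SubChoice_isSubLmodule of image_mod by <:].
End Image.

Section Comparison.
Variable R : nzRingType.

Lemma projective_lift (P B C : lmodType R) (g : {linear B -> C})
    (f : {linear P -> C}) : projective P ->
  (forall x, exists y, f x = g y) -> exists h : {linear P -> B}, forall x, g (h x) = f x.
Proof.
move=> projP fg.
have gI y : g y \in image_pred g by apply/asboolP; exists y.
have fI x : f x \in image_pred g by apply/asboolP.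
pose g' y : image_mod g := Sub (g y) (gI y).
pose f' x : image_mod g := Sub (f x) (fI x).
have linear_g' : linear g'.
  by move=> a x y; apply: val_inj; rewrite linearP !SubK linearP.
have linear_f' : linear f'.
  by move=> a x y; apply: val_inj; rewrite linearP !SubK linearP.
pose gL := GRing.isLinear.Build _ _ _ _ g' linear_g'.
pose fL := GRing.isLinear.Build _ _ _ _ f' linear_f'.
pose G : {linear B -> image_mod g} := HB.pack g' gL.
pose F : {linear P -> image_mod g} := HB.pack f' fL.
have [|h hE] := projP _ _ G F.
  move=> [y yI]; have /asboolP[x yE] := yI.
  by exists x; apply: val_inj; rewrite SubK /= yE.
by exists h => x; have /(congr1 val) := hE x.
Qed.

Variable M : lmodType R.
Implicit Types F G : projective_resolution M.

Lemma res_diff_aug F x : res_aug F (res_diff F 0 x) = 0.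
Proof. by apply/res_exact0; exists x. Qed.

Lemma res_diff_diff F i x : res_diff F i (res_diff F i.+1 x) = 0.
Proof. by apply/res_exactS; exists x. Qed.

Lemma resolution_map F G :
  exists2 phi : forall i, {linear res_mod F i -> res_mod G i},
    forall x, res_aug G (phi 0%N x) = res_aug F x
  & forall i x, res_diff G i (phi i.+1 x) = phi i (res_diff F i x).
Proof.
have [phi0 phi0E] : exists phi0 : {linear res_mod F 0 -> res_mod G 0},
    forall x, res_aug G (phi0 x) = res_aug F x.
  apply: projective_lift; first exact: res_projective.
  by move=> x; have [y] := res_aug_surj G (res_aug F x); exists y.
have [phi1 phi1E] : exists phi1 : {linear res_mod F 1 -> res_mod G 1},
    forall x, res_diff G 0 (phi1 x) = (phi0 \o res_diff F 0) x.
  apply: projective_lift; first exact: res_projective.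
  by move=> x; apply/res_exact0; rewrite /= phi0E res_diff_aug.
(* Each lift depends on the preceding commuting square, so the recursion carries two consecutive
   maps together with their square. *)
pose state i := {s : {linear res_mod F i -> res_mod G i} *
    {linear res_mod F i.+1 -> res_mod G i.+1} |
  forall x, res_diff G i (s.2 x) = s.1 (res_diff F i x)}.
have step i (s : state i) : exists t : state i.+1, (sval t).1 = (sval s).2.
  case: s => -[f g] /= fg.
  have [h hE] : exists h : {linear res_mod F i.+2 -> res_mod G i.+2},
      forall x, res_diff G i.+1 (h x) = (g \o res_diff F i.+1) x.
    apply: projective_lift; first exact: res_projective.
    by move=> x; apply/res_exactS; rewrite /= fg res_diff_diff linear0.
  by exists (exist _ (g, h) hE).
pose st := nat_rect state (exist _ (phi0, phi1) phi1E)
  (fun i s => sval (cid (step i s))).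
exists (fun i => (sval (st i)).1) => // i x.
have -> : (sval (st i.+1)).1 = (sval (st i)).2 by exact: (svalP (cid (step i (st i)))).
exact: (svalP (st i)).
Qed.

Lemma resolution_homotopy F G
    (phi : forall i, {linear res_mod F i -> res_mod G i}) :
  (forall x, res_aug G (phi 0%N x) = 0) ->
  (forall i x, res_diff G i (phi i.+1 x) = phi i (res_diff F i x)) ->
  exists2 s : forall i, {linear res_mod F i -> res_mod G i.+1},
    forall x, phi 0%N x = res_diff G 0 (s 0%N x)
  & forall i x, phi i.+1 x = res_diff G i.+1 (s i.+1 x) + s i (res_diff F i x).
Proof.
move=> phi0 phiS.
have [s0 s0E] : exists s0 : {linear res_mod F 0 -> res_mod G 1},
    forall x, res_diff G 0 (s0 x) = phi 0%N x.
  apply: projective_lift; first exact: res_projective.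
  by move=> x; apply/res_exact0.
(* The recursion carries just the equation that makes the next difference [phi - s d] a cycle. *)
pose state i := {s : {linear res_mod F i -> res_mod G i.+1} |
  forall x, res_diff G i (s (res_diff F i x)) = res_diff G i (phi i.+1 x)}.
have step i (s : state i) : exists t : state i.+1, forall x,
    phi i.+1 x = res_diff G i.+1 (sval t x) + sval s (res_diff F i x).
  case: s => s /= sE.
  have [t tE] : exists t : {linear res_mod F i.+1 -> res_mod G i.+2},
      forall x, res_diff G i.+1 (t x) = (phi i.+1 \- (s \o res_diff F i)) x.
    apply: projective_lift; first exact: res_projective.
    by move=> x; apply/res_exactS; rewrite /= linearB /= sE subrr.
  have tP x : res_diff G i.+1 (t (res_diff F i.+1 x)) = res_diff G i.+1 (phi i.+2 x).
    by rewrite tE /= res_diff_diff linear0 subr0 phiS.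
  by exists (exist _ t tP) => x; rewrite /= tE /= subrK.
have s0P x : res_diff G 0 (s0 (res_diff F 0 x)) = res_diff G 0 (phi 1%N x).
  by rewrite s0E phiS.
pose st := nat_rect state (exist _ s0 s0P) (fun i s => sval (cid (step i s))).
exists (fun i => sval (st i)) => [x | i x]; first by rewrite s0E.
exact: (svalP (cid (step i (st i)))).
Qed.

End Comparison.

(** * Projective dimension and regularity *)

Section FreeModules.
Variables (R : nzRingType) (M : lmodType R) (n : nat) (x : 'I_n -> M).

Definition lincomb (v : 'rV[R]_n) : M := \sum_j v 0 j *: x j.

Fact lincomb_is_linear : linear lincomb.
Proof.
move=> a u v; rewrite /lincomb scaler_sumr -big_split /=.
by apply: eq_bigr => j _; rewrite !mxE scalerDl scalerA.
Qed.
HB.instance Definition _ := GRing.isLinear.Build R 'rV[R]_n M _ lincomb lincomb_is_linear.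

End FreeModules.

Lemma projective_rV (R : nzRingType) n : projective 'rV[R]_n.
Proof.
move=> M N g f g_surj.
have xP j : exists x, g x = f (delta_mx 0 j) by [].
pose x j := sval (cid (xP j)).
exists (lincomb x : {linear _ -> _}) => v.
rewrite linear_sum [v in RHS]row_sum_delta linear_sum; apply: eq_bigr => j _.
by rewrite !linearZ /= (svalP (cid (xP j))).
Qed.

Section PolynomialResolutions.
Variables (k : fieldType) (m : nat).
Local Notation S := {mpoly k[m]}.

(** Kept transparent: the arguments below compute with its modules as row vectors and with its maps
    as matrices. *)
Definition free_projective_resolution (M : lmodType S) (gr : int -> M -> Prop)
    (F : graded_free_resolution gr) : projective_resolution M.
Proof.
apply: (@Build_projective_resolution _ _ (fun i => 'rV[S]_(gfr_rank F i))
  (fun i => mulmxr (gfr_diff F i)) (lincomb (@gfr_aug _ _ _ _ F))).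
- by move=> i; apply: projective_rV.
- by move=> y; have [v ->] := gfr_aug_surj F y; exists v.
- by move=> v; apply: gfr_exact0.
- by move=> i v; apply: gfr_exactS.
Defined.

Lemma graded_free_has_pd_le (M : lmodType S) (gr : int -> M -> Prop)
    (F : graded_free_resolution gr) L :
  (forall i, (L < i)%N -> gfr_rank F i = 0%N) -> has_pd_le M L.
Proof.
move=> F0; exists (free_projective_resolution F) => i /F0 /= r0 x.
by apply/rowP => -[j lt_j]; exfalso; rewrite r0 in lt_j.
Qed.

Lemma minimal_pd_ge (M : lmodType S) (gr : int -> M -> Prop)
    (F : graded_free_resolution gr) L q : minimal_resolution F ->
  (forall i, (L.+1 < i)%N -> gfr_rank F i = 0%N) -> (0 < gfr_rank F L.+1)%N ->
  has_pd_le M q -> (L.+1 <= q)%N.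
Proof.
move=> minF F0 FL [P P0]; rewrite leqNgt; apply/negP => lt_qL.
pose Q := free_projective_resolution F.
have [phi phi0 phiS] := resolution_map Q P.
have [psi psi0 psiS] := resolution_map P Q.
(* [chi] lifts the zero map of [M], hence is null-homotopic; as [P] vanishes in degree [L.+1], it is
   minus the identity there. *)
pose chi i : {linear res_mod Q i -> res_mod Q i} := (psi i \o phi i) \- idfun.
have chiE i x : chi i x = psi i (phi i x) - x by [].
have [|i x|s _ sE] := @resolution_homotopy _ _ Q Q chi.
- by move=> x; rewrite chiE linearB psi0 phi0 subrr.
- by rewrite !chiE linearB psiS phiS.
pose a : 'I_(gfr_rank F L.+1) := Ordinal FL.
pose x : 'rV[S]_(gfr_rank F L.+1) := delta_mx 0 a.
have := sE L x.
have -> : chi L.+1 x = - x.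
  by rewrite chiE (P0 L.+1 _ (phi L.+1 x)) ?linear0 ?sub0r.
have -> : s L.+1 x = 0.
  apply/rowP => -[j lt_j]; exfalso; have := F0 L.+2 (ltnSn _); move: lt_j => /=.
  by move=> + r0; rewrite r0.
rewrite linear0 add0r /= => /matrixP /(_ 0 a).
(* A linear map keeps constant terms zero, so the remaining part of the homotopy, applied to a row
   of the differential, cannot give the entry [-1]. *)
have c0 (v : 'rV[S]_(gfr_rank F L)) j :
    (forall i, (v 0 i)@_0%MM = 0) -> ((s L v : 'rV_(gfr_rank F L.+1)) 0 j)@_0%MM = 0.
  move=> v0; rewrite [v]row_sum_delta (linear_sum (s L)) summxE.
  rewrite (raddf_sum (mcoeff 0%MM)) big1 //= => i _.
  by rewrite linearZ mxE (rmorphM (mcoeff 0%MM)) /= v0 mul0r.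
move=> /(congr1 (mcoeff 0%MM)); rewrite c0; last first.
  by move=> i; rewrite -rowE mxE; apply: minF.
by rewrite !mxE !eqxx mcoeffN mcoeff1 eqxx => /eqP; rewrite oppr_eq0 oner_eq0.
Qed.

Lemma quot_piZ (G : S -> Prop) a f : a *: quot_pi G f = quot_pi G (a * f).
Proof. exact: scale_quot_pi. Qed.

Lemma quot_pi_eq0 (G : S -> Prop) f : quot_pi G f = 0 <-> f \in ideal_gen G.
Proof.
have <- : quot_pi G 0 = 0 by apply: (raddf0 \pi_{ideal_quot ideal_gen G}%qT).
by split=> [/eqP | ?]; [|apply/eqP]; rewrite quot_pi_eq subr0.
Qed.

Section Quotient.
Variables (J : S -> Prop) (L r : nat) (F : ideal_resolution J L r.+1).
Variables (G : S -> Prop).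
Hypothesis GJ : forall f, f \in ideal_gen G <-> J f.
Hypothesis Jm : forall f, J f -> f@_0%MM = 0.

Definition quot_rk i := if i is j.+1 then irk F j else 1%N.

Definition quot_deg i : 'I_(quot_rk i) -> int :=
  match i with 0 => fun=> 0 | j.+1 => fun a => ideg a end.

Definition quot_diff i : 'M[S]_(quot_rk i.+1, quot_rk i) :=
  match i with 0 => iaug F | j.+1 => idiff F j end.

(** Putting [S] in front of the resolution of [J] moves every module up by one homological degree,
    which turns [r.+1] into [r]; the new generator contributes 0, and [r] is a natural number.
    Minimality of the new first map is [Jm]. *)
Lemma quot_resolution : {T : graded_free_resolution (quot_homog G) |
  [/\ minimal_resolution T,
      forall i, (L.+1 < i)%N -> gfr_rank T i = 0%N, (0 < gfr_rank T L.+1)%N,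
      exists i (a : 'I_(gfr_rank T i)), gfr_deg a - i%:Z = r
    & forall i (a : 'I_(gfr_rank T i)), gfr_deg a - i%:Z <= r]}.
Proof.
have augE (v : 'rV_1) : \sum_(a < 1) v 0 a *: quot_pi G 1 = quot_pi G (v 0 0).
  by rewrite big_ord1 quot_piZ mulr1.
unshelve eexists.
  apply: (@Build_graded_free_resolution _ _ _ _ quot_rk quot_deg quot_diff
    (fun _ : 'I_1 => quot_pi G 1)).
  - case=> [|i] a b; last exact: idiff_homog.
    by rewrite /= subr0 [b]ord1; apply: iaug_homog.
  - by move=> a; exists 1 => //=; apply: dhomog1.
  - move=> y; exists (const_mx (quot_repr y)).
    by rewrite augE mxE quot_reprK.
  - move=> v; rewrite augE quot_pi_eq0 GJ (iaug_im F).
    by rewrite -mx11_scalar.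
  - by case=> [|i] v; [apply: iexact0 | apply: iexactS].
split=> /=.
- case=> [|i] a b /=; last exact: idiff_min.
  rewrite [b]ord1; apply: Jm; apply/(iaug_im F); exists (delta_mx 0 a).
  by rewrite -rowE; apply/matrixP => i j; rewrite !ord1 !mxE mulr1n.
- by case=> // i lt_i; apply: (irk_gt F).
- exact: irk_top.
- by have [i [a aE]] := ireg_eq F; exists i.+1, a; move: aE => /=; lia.
- by case=> [|i] a /=; [lia | have := ireg_le a; lia].
Qed.

Lemma quot_pd : is_pd (quot_ideal G) L.+1.
Proof.
have [T [minT T0 TL _ _]] := quot_resolution.
by split; [apply: graded_free_has_pd_le T0 | move=> q; apply: minimal_pd_ge minT T0 TL].
Qed.

Lemma quot_reg : is_reg (quot_homog G) r.
Proof. by have [T [minT _ _ regE regle]] := quot_resolution; exists T. Qed.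

End Quotient.
End PolynomialResolutions.

(** * Products of ideals generated by two coprime monomials *)

Section ProductIdeal.
Variables (k : fieldType) (m : nat).
Local Notation S := {mpoly k[m]}.
Implicit Types (u w : 'X_{1..m}).

(** For factors in disjoint variables the product of ideals is their intersection, so membership is
    one condition per factor. *)
Definition pairs_mnm (p0 : 'X_{1..m}) (p q : nat -> 'X_{1..m}) n u : Prop :=
  (p0 <= u)%MM /\ forall i, (i < n)%N -> (p i <= u)%MM || (q i <= u)%MM.

Lemma pairs_mnm_up p0 p q n : up_closed (pairs_mnm p0 p q n).
Proof.
have up r u w : (r <= u)%MM -> (r <= u + w)%MM.
  by move=> /lepm_trans; apply; apply: lem_addr.
move=> u w [u0 un]; split=> [|i /un]; first exact: up.
by case/orP => /up ->; rewrite ?orbT.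
Qed.

Section Resolution.
Variables (p0 : 'X_{1..m}) (p q : nat -> 'X_{1..m}) (n e : nat).
Hypothesis e_gt0 : (0 < e)%N.
Hypothesis deg_p : forall i, (i < n)%N -> mdeg (p i) = e.
Hypothesis deg_q : forall i, (i < n)%N -> mdeg (q i) = e.
Hypothesis disj_pq : forall i, (i < n)%N -> disjoint_mnm (p i) (q i).
Hypothesis disj_p0 : forall i, (i < n)%N ->
  disjoint_mnm p0 (p i) /\ disjoint_mnm p0 (q i).
Hypothesis disj : forall i j, (i < j < n)%N ->
  [/\ disjoint_mnm (p i) (p j), disjoint_mnm (p i) (q j),
      disjoint_mnm (q i) (p j) & disjoint_mnm (q i) (q j)].

(** The first [j] factors do not involve the variables of [p j], which is therefore regular modulo
    their product; likewise [q j] below. *)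
Let pairs_p j u : (j < n)%N ->
  pairs_mnm p0 p q j (u + p j)%MM -> pairs_mnm p0 p q j u.
Proof.
move=> lt_j [u0 uj]; split=> [|i lt_i].
  by apply: lem_disjoint u0; case: (disj_p0 lt_j).
have [|pp pq qp qq] := disj (i := i) (j := j); first by rewrite lt_i.
by have /orP[/(lem_disjoint pp) -> // | /(lem_disjoint qp) ->] := uj i lt_i; rewrite orbT.
Qed.

Let pairs_q j u : (j < n)%N ->
  pairs_mnm p0 p q j (u + q j)%MM -> pairs_mnm p0 p q j u.
Proof.
move=> lt_j [u0 uj]; split=> [|i lt_i].
  by apply: lem_disjoint u0; case: (disj_p0 lt_j).
have [|pp pq qp qq] := disj (i := i) (j := j); first by rewrite lt_i.
by have /orP[/(lem_disjoint pq) -> // | /(lem_disjoint qq) ->] := uj i lt_i; rewrite orbT.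
Qed.

Lemma pairs_resolution j : (j <= n)%N ->
  inhabited (ideal_resolution (monomial_ideal (k := k) (pairs_mnm p0 p q j)) j
    (mdeg p0 + j * (2 * e - 1))%N).
Proof.
elim: j => [_|j IH lt_j].
  have -> : monomial_ideal (k := k) (pairs_mnm p0 p q 0) = (fun f => exists h, f = h * 'X_[p0]).
    apply/funext => f; apply/propext; split=> [E0 | [h ->]].
      have [|h ->] := @mpolyX_dvd k m p0 f; first by move=> u /E0 [].
      by exists h; rewrite mulrC.
    have [_ _ M] := monomial_ideal_closed k (@pairs_mnm_up p0 p q 0).
    by apply: M; apply/monomial_idealX; split=> //; apply: lepm_refl.
  rewrite addn0; constructor; apply: principal_resolution; first exact: mpolyX_neq0.
  by rewrite dhomogX.
have [F] := IH (ltnW lt_j).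
have -> : (mdeg p0 + j.+1 * (2 * e - 1))%N%:Z =
    (mdeg p0 + j * (2 * e - 1))%N%:Z + (2 * e)%N%:Z - 1.
  by rewrite mulSn; lia.
have homX r : mdeg r = e -> 'X_[r] \is e.-homog by move=> <-; rewrite dhomogX.
have [V0 VD VM] := monomial_ideal_closed k (@pairs_mnm_up p0 p q j.+1).
have [W0 WD WM] := monomial_ideal_closed k (@pairs_mnm_up p0 p q j).
constructor; apply: (cone_resolution F (p := 'X_[p j]) (q := 'X_[q j])) => //.
- exact: mpolyX_neq0.
- exact/homX/deg_p.
- exact/homX/deg_q.
- have := deg_p lt_j; rewrite mcoeffX; case: eqP => // ->; rewrite mdeg0; lia.
- have := deg_q lt_j; rewrite mcoeffX; case: eqP => // ->; rewrite mdeg0; lia.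
- move=> f; split.
    apply: (@monomial_ideal_ind _ _ _ (fun f => exists g h,
      [/\ monomial_ideal (pairs_mnm p0 p q j) g, monomial_ideal (pairs_mnm p0 p q j) h &
          f = 'X_[p j] * g + 'X_[q j] * h])).
      split; first by exists 0, 0; rewrite !mulr0 addr0.
      + move=> _ _ [g [h [Eg Eh ->]]] [g' [h' [Eg' Eh' ->]]].
        exists (g + g'), (h + h'); split; [exact: WD | exact: WD |].
        by rewrite !mulrDr addrACA.
      + move=> a _ [g [h [Eg Eh ->]]]; exists (a * g), (a * h).
        by split; [exact: WM | exact: WM |]; rewrite mulrDr !(mulrCA a).
    move=> u [u0 uj]; have Eu : pairs_mnm p0 p q j u.
      by split=> // i lt_i; apply: uj; apply: ltnW.
    have /orP[le_u | le_u] := uj j (ltnSn j).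
      exists 'X_[u - p j], 0; rewrite mulr0 addr0 -mpolyXD addmC submK //; split=> //.
      by apply/monomial_idealX; apply: pairs_p => //; rewrite submK.
    exists 0, 'X_[u - q j]; rewrite mulr0 add0r -mpolyXD addmC submK //; split=> //.
    by apply/monomial_idealX; apply: pairs_q => //; rewrite submK.
  have sub r g : monomial_ideal (pairs_mnm p0 p q j) g -> r = p j \/ r = q j ->
      monomial_ideal (pairs_mnm p0 p q j.+1) ('X_[r] * g).
    move=> Eg rE; apply/monomial_idealMX => u /Eg /(@pairs_mnm_up _ _ _ _ _ r) [u0 uj].
    split=> // i; rewrite ltnS leq_eqVlt => /orP[/eqP -> | /uj //].
    by case: rE => <-; rewrite lem_addl ?orbT.
  by move=> [g [h [Eg Eh ->]]]; apply: VD; apply: sub; auto.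
- move=> f g Ef Eg /(mpolyX_syzygy (disj_pq lt_j))[h fE gE]; exists h; split=> //.
  by move: Ef; rewrite fE => /monomial_idealMX Eh u /Eh; apply: pairs_q.
Qed.

Hypothesis n_gt0 : (0 < n)%N.

Let pairs_max (f : S) : monomial_ideal (pairs_mnm p0 p q n) f -> f@_0%MM = 0.
Proof.
move=> Ef; apply/eqP/negPn/negP => /Ef[_ /(_ 0%N n_gt0)].
have le0 r : (r <= 0)%MM -> mdeg r = 0%N.
  move=> /mnm_lepP r0; apply/eqP; rewrite mdeg_eq0; apply/eqP/mnmP => i.
  by have := r0 i; rewrite mnm0E; lia.
by case/orP => /le0; rewrite ?deg_p ?deg_q //; lia.
Qed.

Lemma pairs_pd_reg (G : S -> Prop) r :
  (forall f, f \in ideal_gen G <-> monomial_ideal (pairs_mnm p0 p q n) f) ->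
  (mdeg p0 + n * (2 * e - 1) = r.+1)%N ->
  is_pd (quot_ideal G) n.+1 /\ is_reg (quot_homog G) r.
Proof.
move=> GE rE; have [] := pairs_resolution (leqnn n); rewrite rE => F.
by split; [apply: (quot_pd F) | apply: (quot_reg F)].
Qed.
End Resolution.
End ProductIdeal.

(** * Koszul homology and regular sequences *)

Section Koszul.
Variable R : comNzRingType.
Implicit Types (U : R -> Prop) (xs s t : seq R) (x f : R).

(** The exterior algebra on [xs] as an iterated cone: the second component is the coefficient of the
    generator of the head. The complex is one ungraded module with its degrees given by the
    predicate [kdeg], which avoids families of dependent types. *)
Fixpoint koszul xs : lmodType R :=
  if xs is _ :: xs' then (koszul xs' * koszul xs')%type else R^o.

Fixpoint kdiff xs : koszul xs -> koszul xs :=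
  match xs with
  | [::] => fun=> 0
  | x :: xs' => fun z => (kdiff z.1 + x *: z.2, - kdiff z.2)
  end.

Fact kdiff_is_linear xs : linear (@kdiff xs).
Proof.
elim: xs => [|x xs IH] a u v /=; first by rewrite scaler0 addr0.
congr pair; last by rewrite /= IH opprD scalerN.
by rewrite /= IH !scalerDr !scalerA [x * a]mulrC addrACA.
Qed.
HB.instance Definition _ xs :=
  GRing.isLinear.Build R (koszul xs) (koszul xs) _ (@kdiff xs) (@kdiff_is_linear xs).

Lemma kdiffK xs (z : koszul xs) : kdiff (kdiff z) = 0.
Proof.
elim: xs z => [//|x xs IH] [a b] /=; congr pair; last by rewrite linearN /= IH !oppr0.
by rewrite linearD linearZ /= IH add0r scalerN subrr.
Qed.

Fixpoint kdeg xs : nat -> koszul xs -> Prop :=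
  match xs with
  | [::] => fun i z => if i is _.+1 then z = 0 else True
  | x :: xs' => fun i z =>
      kdeg i z.1 /\ (if i is j.+1 then kdeg j z.2 else z.2 = 0)
  end.

Lemma kdegP xs i a (u v : koszul xs) : kdeg i u -> kdeg i v -> kdeg i (a *: u + v).
Proof.
elim: xs i u v => [|x xs IH] [|i] // u v /=.
- by move=> -> ->; rewrite scaler0 addr0.
- by move=> [u1 ->] [v1 ->]; split; [apply: IH | rewrite scaler0 addr0].
- by move=> [u1 u2] [v1 v2]; split; apply: IH.
Qed.

Lemma kdeg0 xs i : kdeg i (0 : koszul xs).
Proof. by elim: xs i => [|x xs IH] [|i] //=; split. Qed.

Lemma kdegZ xs i a (u : koszul xs) : kdeg i u -> kdeg i (a *: u).
Proof. by move=> ui; rewrite -[_ *: _]addr0; apply: kdegP => //; apply: kdeg0. Qed.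

Lemma kdegD xs i (u v : koszul xs) : kdeg i u -> kdeg i v -> kdeg i (u + v).
Proof. by move=> ui vi; rewrite -[u]scale1r; apply: kdegP. Qed.

Lemma kdegN xs i (u : koszul xs) : kdeg i u -> kdeg i (- u).
Proof. by rewrite -scaleN1r; apply: kdegZ. Qed.

Lemma kdeg_diff xs i (z : koszul xs) : kdeg i.+1 z -> kdeg i (kdiff z).
Proof.
elim: xs i z => [|x xs IH] i z; first by move=> _; apply: kdeg0.
case: z => a b /=.
move=> [ai bi]; split; first by apply: kdegD; [apply: IH | apply: kdegZ].
case: i ai bi => [|i] _ bi; last by apply: kdegN; apply: IH.
suff -> : kdiff b = 0 by rewrite oppr0.
elim: xs {IH a} b bi => [//|y xs IH] [a b] /= [a0 ->].
by rewrite IH // !linear0 addr0 ?oppr0.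
Qed.

Lemma kdiff_deg0 xs (z : koszul xs) : kdeg 0 z -> kdiff z = 0.
Proof.
elim: xs z => [//|y xs IH] [a b] /= [a0 ->].
by rewrite IH // !linear0 addr0 ?oppr0.
Qed.

Lemma kdeg_gt_size xs i (z : koszul xs) : (size xs < i)%N -> kdeg i z -> z = 0.
Proof.
elim: xs i z => [|x xs IH] [|i] //= [a b] /= lt_i [/IH -> //]; last by lia.
by move/IH => -> //.
Qed.

(** The kernel of reduction modulo [U]; cycles and boundaries over the quotient ring are expressed
    through it on lifts to [R]. *)
Fixpoint kin U xs : koszul xs -> Prop :=
  match xs with
  | [::] => U
  | x :: xs' => fun z => kin U z.1 /\ kin U z.2
  end.

Section Ideal.
Variable U : R -> Prop.
Hypothesis idU : ideal_closed U.

Lemma kin0 xs : kin U (0 : koszul xs).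
Proof. by elim: xs => [|x xs IH] /=; [case: idU | split]. Qed.

Lemma kinD xs (u v : koszul xs) : kin U u -> kin U v -> kin U (u + v).
Proof.
elim: xs u v => [|x xs IH] u v /=; first by case: idU => _ + _; apply.
by move=> [u1 u2] [v1 v2]; split; apply: IH.
Qed.

Lemma kinZ xs a (u : koszul xs) : kin U u -> kin U (a *: u).
Proof.
elim: xs u => [|x xs IH] u /=; first by case: idU => _ _; apply.
by move=> [u1 u2]; split; apply: IH.
Qed.

Lemma kinN xs (u : koszul xs) : kin U u -> kin U (- u).
Proof. by rewrite -scaleN1r; apply: kinZ. Qed.

Lemma kin_diff xs (u : koszul xs) : kin U u -> kin U (kdiff u).
Proof.
elim: xs u => [|x xs IH] u /=; first by case: idU.
move=> [u1 u2]; split; last by apply: kinN; apply: IH.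
by apply: kinD; [apply: IH | apply: kinZ].
Qed.

Lemma kin_nzd xs f (u : koszul xs) :
  (forall x, U (f * x) -> U x) -> kin U (f *: u) -> kin U u.
Proof.
move=> nzd; elim: xs u => [|x xs IH] u /=; first exact: nzd.
by move=> [u1 u2]; split; apply: IH.
Qed.

Definition kadd f : R -> Prop := fun x => exists y, U (x - f * y).

Lemma kin_kadd xs f (z w : koszul xs) : kin U (z - f *: w) -> kin (kadd f) z.
Proof.
elim: xs z w => [|x xs IH] z w /=; first by exists w.
by move=> [u1 u2]; split; [apply: IH u1 | apply: IH u2].
Qed.

Lemma kin_sub_kadd xs f (z : koszul xs) : kin U z -> kin (kadd f) z.
Proof. by move=> Uz; apply: (@kin_kadd _ _ _ 0); rewrite scaler0 subr0. Qed.

Lemma kin_kaddP xs f i (z : koszul xs) : kdeg i z -> kin (kadd f) z ->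
  exists2 w, kdeg i w & kin U (z - f *: w).
Proof.
elim: xs i z => [|x xs IH] i z /=.
  case: i => [_ [w Uw] | i -> _]; first by exists w.
  by exists 0 => //; rewrite scaler0 subr0; case: idU.
case: z => a b /= [ai bi] [Ua Ub]; have [v vi Uv] := IH i a ai Ua.
case: i ai bi vi Uv => [|i] ai bi vi Uv.
  exists (v, 0) => //=; split=> //; rewrite bi scaler0 subr0; exact: kin0.
by have [w wi Uw] := IH i b bi Ub; exists (v, w).
Qed.

Definition koszul_homology_neq0 xs i : Prop :=
  exists z : koszul xs, [/\ kdeg i z, kin U (kdiff z) &
    ~ exists2 v, kdeg i.+1 v & kin U (z - kdiff v)].

Lemma koszul_homology_le xs i : koszul_homology_neq0 xs i -> (i <= size xs)%N.
Proof.
move=> [z [zi _ nb]]; rewrite leqNgt; apply/negP => lt_i; apply: nb.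
exists 0; first exact: kdeg0.
by rewrite (kdeg_gt_size lt_i zi) linear0 subr0; apply: kin0.
Qed.

Fixpoint ktop xs (w : R) : koszul xs :=
  match xs with [::] => w | x :: xs' => (0, ktop xs' w) end.

(** The top exterior product with coefficient [w] has a differential with coefficients [x * w] up to
    sign, and no boundary but 0 exists in the top degree. *)
Lemma koszul_homology_socle xs w : ~ U w -> {in xs, forall x, U (x * w)} ->
  koszul_homology_neq0 xs (size xs).
Proof.
move=> nUw xw; exists (ktop xs w); split.
- by elim: xs {xw} => [|x xs IH] //=; split => //; apply: kdeg0.
- have top_in ys x : U (x * w) -> kin U (x *: ktop ys w).
    move=> Ux; elim: ys => [|y ys IH] //=; split=> //.
    by rewrite /= scaler0; apply: kin0.
  elim: xs xw => [|x xs IH] xw /=; first by case: idU.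
  split; last by apply: kinN; apply: IH => y ys; apply: xw; rewrite inE ys orbT.
  by rewrite linear0 add0r; apply: top_in; apply: xw; rewrite mem_head.
- move=> [v /(kdeg_gt_size (ltnSn _)) ->]; rewrite linear0 subr0.
  by elim: xs {xw v} => [|x xs IH] //= [_ /IH].
Qed.

(** Exactness of [H_i(U) -> H_i(U + (f)) -> H_(i-1)(U)] by hand: [kdiff z] equals [f *: w] modulo
    [U], and [w] is a cycle. Either [w] gives a nonzero class, or it bounds some [v] and
    [z - f *: v] gives one. *)
Lemma koszul_homology_down xs f i : (forall x, U (f * x) -> U x) ->
  (exists z : koszul xs, [/\ kdeg i z, kin (kadd f) (kdiff z) &
    ~ exists2 v, kdeg i.+1 v & kin (kadd f) (z - kdiff v)]) ->
  exists j, (j <= i <= j.+1)%N /\ koszul_homology_neq0 xs j.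
Proof.
move=> nzd [z [zi Uz nb]]; case: i zi nb => [|i] zi nb.
  exists 0%N; split=> //; exists z; split=> //; first by rewrite kdiff_deg0 //; apply: kin0.
  by move=> [v v1 Uv]; apply: nb; exists v => //; apply: kin_sub_kadd.
have [w wi Uw] := kin_kaddP (kdeg_diff zi) Uz.
have Udw : kin U (kdiff w).
  apply: (kin_nzd nzd); rewrite -[f *: kdiff w]opprK; apply: kinN.
  by have := kin_diff Uw; rewrite linearB linearZ /= kdiffK sub0r.
case: (pselect (exists2 v, kdeg i.+1 v & kin U (w - kdiff v))) => [[v vi Uv]|nw].
  exists i.+1; split; first by lia.
  exists (z - f *: v); split.
  - by apply: kdegD => //; apply: kdegN; apply: kdegZ.
  - rewrite linearB linearZ /= -(subrK (f *: w) (kdiff z)) -addrA -scalerBr.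
    by apply: kinD => //; apply: kinZ.
  - move=> [u ui Uu]; apply: nb; exists u => //; apply: (@kin_kadd _ f _ v).
    by rewrite addrAC.
by exists i; split; [lia | exists w].
Qed.

(** Multiplication by [f] is null-homotopic. The homotopy has to respect every ideal [V], because
    the ideal modulo which it is used grows along a regular sequence. *)
Definition kcontractible xs f := exists H : {linear koszul xs -> koszul xs},
  [/\ forall z, kdiff (H z) + H (kdiff z) = f *: z,
      forall i z, kdeg i z -> kdeg i.+1 (H z)
    & forall V z, ideal_closed V -> kin V z -> kin V (H z)].

(** [H z] is a cycle modulo [f], since its differential is [f *: z - H (kdiff z)]. If it differed
    from a boundary by [f *: u], applying the differential would give [f *: z = f *: kdiff u] modulo
    [U], and cancelling [f] would make [z] a boundary. *)
Lemma koszul_homology_up xs f i : kcontractible xs f ->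
  (forall x, U (f * x) -> U x) -> koszul_homology_neq0 xs i ->
  exists z : koszul xs, [/\ kdeg i.+1 z, kin (kadd f) (kdiff z) &
    ~ exists2 v, kdeg i.+2 v & kin (kadd f) (z - kdiff v)].
Proof.
move=> [H [HE Hdeg Hin]] nzd [z [zi Uz nb]].
have dH : kdiff (H z) - f *: z = - H (kdiff z).
  by rewrite -HE opprD addrA subrr add0r.
exists (H z); split; first exact: Hdeg.
  by apply: (@kin_kadd _ f _ z); rewrite dH; apply: kinN; apply: Hin.
move=> [v vi Uv]; have Hi : kdeg i.+1 (H z - kdiff v).
  by apply: kdegD; [apply: Hdeg | apply: kdegN; apply: kdeg_diff].
have [u ui Uu] := kin_kaddP Hi Uv.
apply: nb; exists u => //; apply: (kin_nzd nzd).
have := kin_diff Uu; rewrite !linearB /= kdiffK subr0 linearZ /= => Ud.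
have := kinD Ud (Hin _ _ idU Uz).
by rewrite addrAC HE -scalerBr.
Qed.
End Ideal.

Lemma kcontractible_closed xs : ideal_closed (kcontractible xs).
Proof.
split.
- exists \0; split=> [z|i z _|V z idV _] /=; rewrite ?linear0 ?addr0 ?scale0r //.
    exact: kdeg0.
  exact: kin0.
- move=> f g [H [HE Hd Hi]] [H' [HE' Hd' Hi']]; exists (H \+ H').
  split=> [z|i z zi|V z idV Vz] /=.
  + by rewrite linearD addrACA HE HE' scalerDl.
  + by apply: kdegD; [apply: Hd | apply: Hd'].
  + by apply: kinD; [|apply: Hi|apply: Hi'].
- move=> a f [H [HE Hd Hi]]; exists (a \*: H).
  split=> [z|i z zi|V z idV Vz] /=.
  + by rewrite linearZ /= -scalerDr HE scalerA.
  + by apply: kdegZ; apply: Hd.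
  + by apply: kinZ; [|apply: Hi].
Qed.

(** The homotopy is exterior multiplication by the generator of [x]. Together with
    [kcontractible_closed] this covers the whole ideal generated by [xs]. *)
Lemma kcontractible_mem xs x : x \in xs -> kcontractible xs x.
Proof.
elim: xs => [//|y xs IH]; rewrite inE => /orP[/eqP -> {IH x} | /IH [H [HE Hd Hi]]].
  pose H (z : koszul (y :: xs)) : koszul (y :: xs) := (0, z.1).
  have linH : linear H by move=> a u v; rewrite /H; congr pair; rewrite /= scaler0 addr0.
  pose HL := GRing.isLinear.Build _ _ _ _ H linH.
  exists (HB.pack H HL : {linear _ -> _}).
  split=> [[a b]|i [a b] [ai bi]|V [a b] idV [Va Vb]] /=.
  + by congr pair; rewrite /= ?linear0 ?add0r ?addr0 // addKr.
  + by split => //; apply: kdeg0.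
  + by split => //; apply: kin0.
(* The sign comes from moving past the generator of [y]. *)
pose H' (z : koszul (y :: xs)) : koszul (y :: xs) := (H z.1, - H z.2).
have linH : linear H'.
  by move=> a u v; rewrite /H'; congr pair; rewrite /= linearP // opprD scalerN.
pose HL := GRing.isLinear.Build _ _ _ _ H' linH.
exists (HB.pack H' HL : {linear _ -> _}).
split=> [[a b]|i [a b] [ai bi]|V [a b] idV [Va Vb]] /=.
- congr pair; rewrite /=.
    have HZ : H (y *: b) = y *: H b by rewrite linearZ.
    by rewrite linearD /= HZ scalerN addrACA addNr addr0 HE.
  by rewrite !linearN /= opprK opprK HE.
- split; first exact: Hd.
  by case: i ai bi => [|i] ai /=; [move=> ->; rewrite linear0 oppr0; apply: kdeg0
    | move=> bi; apply: kdegN; apply: Hd].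
- by split; [|apply: kinN => //]; apply: Hi.
Qed.

Definition regular_mod U s := forall i f, (i < size s)%N ->
  ideal_add U (take i s) (s`_i * f) -> ideal_add U (take i s) f.

Lemma regular_mod_rcons U s g : regular_mod U (rcons s g) ->
  regular_mod U s /\ forall f, ideal_add U s (g * f) -> ideal_add U s f.
Proof.
move=> reg; split=> [i f lt_i | f].
  have := reg i f; rewrite size_rcons nth_rcons lt_i -cats1 takel_cat; last exact: ltnW.
  by apply; apply: ltnW.
have := reg (size s) f; rewrite size_rcons nth_rcons ltnn eqxx -cats1 take_size_cat //.
by apply.
Qed.

Lemma ideal_add_rconsE U s g : ideal_closed U ->
  ideal_add U (rcons s g) = kadd (ideal_add U s) g.
Proof. by move=> idU; apply/funext => f; apply/propext/ideal_add_rcons. Qed.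

Lemma koszul_homology_up_seq U xs s i : ideal_closed U -> regular_mod U s ->
  {in s, forall f, f \in ideal_gen (fun x => x \in xs)} ->
  koszul_homology_neq0 U xs i ->
  koszul_homology_neq0 (ideal_add U s) xs (i + size s).
Proof.
move=> idU; elim/last_ind: s => [|s g IH] reg sxs h.
  rewrite addn0; suff -> : ideal_add U [::] = U by [].
  by apply/funext => f; apply/propext/ideal_add_nil.
have [regs nzd] := regular_mod_rcons reg.
rewrite size_rcons addnS ideal_add_rconsE //.
apply: koszul_homology_up => //; first exact: ideal_add_closed.
  apply: (ideal_gen_min (kcontractible_closed xs)) => [x|].
    exact: kcontractible_mem.
  by apply: sxs; rewrite mem_rcons mem_head.
by apply: IH => // f fs; apply: sxs; rewrite mem_rcons inE fs orbT.
Qed.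

Lemma koszul_homology_down_seq U xs t i : ideal_closed U -> regular_mod U t ->
  koszul_homology_neq0 (ideal_add U t) xs i ->
  exists j, (i <= j + size t)%N /\ koszul_homology_neq0 U xs j.
Proof.
move=> idU; elim/last_ind: t i => [|t g IH] i reg.
  suff -> : ideal_add U [::] = U by move=> h; exists i; rewrite addn0.
  by apply/funext => f; apply/propext/ideal_add_nil.
have [regt nzd] := regular_mod_rcons reg; rewrite ideal_add_rconsE // => h.
have [|j [le_j hj]] := koszul_homology_down _ nzd h; first exact: ideal_add_closed.
have [l [le_l hl]] := IH j regt hj; exists l; split=> //.
by rewrite size_rcons; lia.
Qed.

(* A socle element modulo a regular sequence [t] shows that [t] is a longest
   regular sequence in the ideal of [xs]. *)
Lemma regular_mod_size U xs s t w : ideal_closed U ->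
  regular_mod U t -> ~ ideal_add U t w ->
  {in xs, forall x, ideal_add U t (x * w)} ->
  regular_mod U s -> {in s, forall f, f \in ideal_gen (fun x => x \in xs)} ->
  (size s <= size t)%N.
Proof.
move=> idU regt nw xw regs sxs.
have idt := ideal_add_closed t idU.
have [j [le_j hj]] := koszul_homology_down_seq idU regt (koszul_homology_socle idt nw xw).
have := koszul_homology_le (ideal_add_closed s idU) (koszul_homology_up_seq idU regs sxs hj).
by lia.
Qed.

End Koszul.

(** * Regular sequences of differences of variables *)

Section Identification.
Variables (k : fieldType) (m : nat).
Local Notation S := {mpoly k[m]}.
Implicit Types (E : 'X_{1..m} -> Prop) (u v w : 'X_{1..m}) (c d i : 'I_m) (f g h : S).

Definition mnm_merge c d u : 'X_{1..m} :=
  [multinom if i == c then 0%N else if i == d then (u c + u d)%N else u i | i < m].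

Definition var_subst c d : S -> S :=
  mmap (@mpolyC m k) (fun i => 'X_(if i == c then d else i)).
HB.instance Definition _ c d := GRing.RMorphism.on (var_subst c d).

Lemma var_substX c d u : c != d -> var_subst c d 'X_[u] = 'X_[mnm_merge c d u].
Proof.
move=> ncd; have ndc : d != c by rewrite eq_sym.
rewrite /var_subst mmapX /mmap1 mprodXnE; congr 'X_[_].
apply/mnmP => i; rewrite mnm_sumE mnmE.
under eq_bigr => j _ do rewrite mulmnE mnm1E.
have [-> | nic] := eqVneq i c.
  rewrite big1 // => j _; have [_ | jc] := eqVneq j c; last by rewrite (negPf jc).
  by rewrite eq_sym (negPf ncd).
have [-> | nid] := eqVneq i d.
  rewrite (bigD1 c) //= eqxx eqxx mul1n (bigD1 d) ?(negPf ndc) //= eqxx mul1n big1 ?addn0 // => j /andP[jc jd].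
  by rewrite (negPf jc) (negPf jd).
rewrite (bigD1 i) //= (negPf nic) eqxx mul1n big1 ?addn0 // => j ji.
have [_ | _] := eqVneq j c; last by rewrite (negPf ji).
by rewrite eq_sym (negPf nid).
Qed.

Lemma rmorph_mpolyX_fixed (phi : {rmorphism S -> S}) u :
  (forall i, u i != 0%N -> phi 'X_i = 'X_i) -> phi 'X_[u] = 'X_[u].
Proof.
move=> fixu; rewrite mpolyXE_id rmorph_prod; apply: eq_bigr => i _.
by rewrite rmorphXn; have [-> // | /fixu ->] := eqVneq (u i) 0%N.
Qed.

Lemma var_subst_cong c d f : exists h, f - var_subst c d f = ('X_c - 'X_d) * h.
Proof.
pose P f := exists h, f - var_subst c d f = ('X_c - 'X_d) * h.
have PD f1 f2 : P f1 -> P f2 -> P (f1 + f2).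
  move=> [h1 e1] [h2 e2]; exists (h1 + h2).
  by rewrite rmorphD opprD addrACA e1 e2 mulrDr.
have PM f1 f2 : P f1 -> P f2 -> P (f1 * f2).
  move=> [h1 e1] [h2 e2]; exists (h1 * f2 + var_subst c d f1 * h2).
  rewrite mulrDr mulrA -e1 mulrCA -e2 rmorphM /= mulrBl mulrBr addrA subrK //.
have P0 f1 : var_subst c d f1 = f1 -> P f1 by exists 0; rewrite H subrr mulr0.
have PX i : P 'X_i.
  rewrite /P /var_subst mmapX mmap1U; case: eqP => [-> | _].
    by exists 1; rewrite mulr1.
  by exists 0; rewrite subrr mulr0.
rewrite -/(P f) [f]mpolyE; apply: (big_ind P) => [||u _].
- by apply: P0; rewrite rmorph0.
- exact: PD.
rewrite -mul_mpolyC; apply: (PM); first by apply: P0; rewrite /var_subst mmapC.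
rewrite mpolyXE_id; apply: (big_ind P) => [||i _].
- by apply: P0; rewrite rmorph1.
- exact: PM.
elim: (u i) => [|r IH]; first by apply: P0; rewrite expr0 rmorph1.
by rewrite exprS; apply: (PM).
Qed.

Lemma monomial_ideal_subst E E' c d f : up_closed E' -> c != d ->
  (forall u, E u -> E' (mnm_merge c d u)) ->
  monomial_ideal E f -> monomial_ideal E' (var_subst c d f).
Proof.
move=> upE' ncd EE'; have [V0 VD VM] := monomial_ideal_closed k upE'.
apply: (@monomial_ideal_ind _ _ _ (fun f => monomial_ideal E' (var_subst c d f))).
  split=> [|f1 f2 F1 F2|a f1 F1]; first by rewrite rmorph0.
    by rewrite rmorphD; apply: VD.
  by rewrite rmorphM; apply: VM.
by move=> u /EE' Eu; rewrite var_substX //; apply/monomial_idealX.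
Qed.

(* [phi] identifies the variables whose differences are in [t]; it reduces
   membership in [J + (t)] to membership in the monomial ideal of [E]. *)
Record identification (J : S -> Prop) (D : 'I_m -> Prop) (t : seq S)
    (phi : {rmorphism S -> S}) E : Prop := {
  id_up : up_closed E;
  id_regular : regular_mod J t;
  id_fixed : forall i, D i -> phi 'X_i = 'X_i;
  id_ideal : forall f, J f -> monomial_ideal E (phi f);
  id_kills : {in t, forall g, phi g = 0};
  id_cong : forall f, ideal_add J t (f - phi f);
  id_mnm : forall u, E u -> ideal_add J t 'X_[u] }.

Section Identify.
Variables (J : S -> Prop) (idJ : ideal_closed J).

Lemma id_iff D t phi E f : identification J D t phi E ->
  ideal_add J t f <-> monomial_ideal E (phi f).
Proof.
move=> st; have idt := ideal_add_closed t idJ; split.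
  have [V0 VD VM] := monomial_ideal_closed k (id_up st).
  apply: (@ideal_add_min _ _ (fun f => monomial_ideal E (phi f))).
  - split=> [|f1 f2 F1 F2|a f1 F1]; first by rewrite rmorph0.
      by rewrite rmorphD; apply: VD.
    by rewrite rmorphM; apply: VM.
  - exact: (id_ideal st).
  - by move=> g /(id_kills st) ->.
move=> Ef; rewrite -(subrK (phi f) f); case: (idt) => _ VD _; apply: VD.
  exact: (id_cong st).
by apply: monomial_ideal_ind Ef => // u; apply: (id_mnm st).
Qed.

Lemma regular_mod_rconsI s g : regular_mod J s ->
  (forall f, ideal_add J s (g * f) -> ideal_add J s f) -> regular_mod J (rcons s g).
Proof.
move=> reg nzd i f; rewrite size_rcons ltnS leq_eqVlt => /orP[/eqP -> | lt_i].
  by rewrite nth_rcons ltnn eqxx -cats1 take_size_cat //; apply: nzd.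
by rewrite nth_rcons lt_i -cats1 takel_cat; [apply: reg | apply: ltnW].
Qed.

Lemma identification_start D E : up_closed E -> (forall f, J f <-> monomial_ideal E f) ->
  identification J D [::] idfun E.
Proof.
move=> upE JE; split=> //.
- by move=> f /JE.
- by move=> f /=; rewrite subrr; case: (ideal_add_closed [::] idJ).
- by move=> u Eu; apply/(ideal_add_nil _ idJ)/JE/monomial_idealX.
Qed.

(** [E1] and [E2] witness that ['X_c - 'X_d] is regular, and [E'] is the image of [E] under the
    substitution. The converse inclusion is asked only up to merging, because [E'] also contains
    exponents that involve the eliminated variable [c]. *)
Lemma identification_step (D : 'I_m -> Prop) t (phi : {rmorphism S -> S}) E E' E1 E2 c d :
  identification J D t phi E -> D c -> D d -> c != d ->
  up_closed E1 -> up_closed E2 -> (forall u, E u <-> E1 u /\ E2 u) ->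
  (forall u, E1 (u + U_(c))%MM -> E1 u) ->
  (forall u, E2 (u + U_(d))%MM -> E2 u) ->
  up_closed E' -> (forall u, E u -> E' (mnm_merge c d u)) ->
  (forall v, E' v -> exists2 w, E w & mnm_merge c d w = mnm_merge c d v) ->
  identification J (fun i => D i /\ i <> c) (rcons t ('X_c - 'X_d))
    (var_subst c d \o phi) E'.
Proof.
move=> st Dc Dd ncd up1 up2 EE Ec Ed upE' EE' E'E.
have tE f : ideal_add J t f -> ideal_add J (rcons t ('X_c - 'X_d)) f.
  by move=> Uf; apply/ideal_add_rcons => //; exists 0; rewrite mulr0 subr0.
have [V0 VD VM] := ideal_add_closed (rcons t ('X_c - 'X_d)) idJ.
have cong f : ideal_add J (rcons t ('X_c - 'X_d)) (f - var_subst c d f).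
  have [h ->] := var_subst_cong c d f; rewrite mulrC; apply: VM.
  by apply: ideal_add_mem; rewrite // mem_rcons mem_head.
have phig : phi ('X_c - 'X_d) = 'X_c - 'X_d.
  by rewrite rmorphB (id_fixed st Dc) (id_fixed st Dd).
split.
- exact: upE'.
- apply: regular_mod_rconsI; first exact: (id_regular st).
  move=> f /(id_iff _ st); rewrite rmorphM phig => Ef; apply/(id_iff _ st).
  exact: monomial_ideal_nzd up1 up2 ncd EE Ec Ed Ef.
- move=> i [Di /eqP ic] /=; rewrite (id_fixed st Di) /var_subst mmapX mmap1U.
  by rewrite (negPf ic).
- by move=> f /(id_ideal st); apply: monomial_ideal_subst.
- move=> g; rewrite mem_rcons inE => /orP[/eqP -> | /(id_kills st) /= ->]; last exact: rmorph0.
  rewrite /= phig rmorphB /= /var_subst !mmapX !mmap1U eqxx eq_sym (negPf ncd).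
  exact: subrr.
- move=> f /=; have -> : f - var_subst c d (phi f) = (f - phi f) + (phi f - var_subst c d (phi f)).
    by rewrite addrA subrK.
  by apply: VD => //; apply: tE; apply: (id_cong st).
- move=> v /E'E[w Ew wv].
  have -> : 'X_[v] = ('X_[v] - var_subst c d 'X_[v]) +
      (-1 * ('X_[w] - var_subst c d 'X_[w]) + 'X_[w]) :> S.
    by rewrite !var_substX // wv mulN1r opprB !subrK.
  apply: (VD) => //; apply: VD; first exact: VM.
  by apply: tE; apply: (id_mnm st).
Qed.

End Identify.
End Identification.

Section Sequences.
Variables (k : fieldType) (m : nat).
Local Notation S := {mpoly k[m]}.
Implicit Types (u v w : 'X_{1..m}) (c d : 'I_m) (f g h : S) (D : 'I_m -> Prop).
Variables (J : S -> Prop) (idJ : ideal_closed J).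

Lemma identification_weaken D D' t (phi : {rmorphism S -> S}) E :
  (forall i, D' i -> D i) -> identification J D t phi E -> identification J D' t phi E.
Proof. by move=> DD' [? ? fixD ? ? ? ?]; split=> // i /DD' /fixD. Qed.

Lemma mnm_merge_move c d u r : c != d -> (r <= u d)%N ->
  exists2 w, mnm_merge c d w = mnm_merge c d u &
    [/\ w c = (u c + r)%N, w d = (u d - r)%N & forall i, i != c -> i != d -> w i = u i].
Proof.
move=> ncd le_r; have ndc : d != c by rewrite eq_sym.
exists [multinom if i == c then (u c + r)%N else if i == d then (u d - r)%N else u i | i < m].
  apply/mnmP => i; rewrite !mnmE eqxx (negPf ndc) eqxx.
  by case: eqP => // _; case: eqP => // _; lia.
by split=> [||i /negPf ic /negPf id]; rewrite mnmE ?eqxx ?(negPf ndc) ?ic ?id.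
Qed.

Section Glue.
Variables (N e : nat) (a : nat -> 'I_m) (beta : nat -> 'X_{1..m} -> bool).
Hypothesis a_inj : forall i j, (i < N)%N -> (j < N)%N -> a i = a j -> i = j.
Hypothesis beta_up : forall i u w, beta i u -> beta i (u + w)%MM.
Hypothesis beta_indep : forall i u v,
  (forall x, (forall j, (j < N)%N -> x != a j) -> u x = v x) -> beta i u = beta i v.

(** The product of the ideals [(a_i^e, b_i)], with [beta i] standing for membership in [(b_i)], once
    [a_1, ..., a_j] have become [a_0]: each of the factors up to [j] that is not met through [b_i]
    costs [e] copies of [a_0]. *)
Definition glue_mnm j u : Prop :=
  (e * \sum_(i < j.+1) ~~ beta i u <= u (a 0))%N /\
  forall i, (j < i < N)%N -> (e <= u (a i))%N || beta i u.

Let beta_merge i j u : (j < N)%N -> (0 < N)%N ->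
  beta i (mnm_merge (a j) (a 0) u) = beta i u.
Proof.
move=> lt_j lt_0; apply: beta_indep => x xa.
by rewrite mnmE (negPf (xa _ lt_j)) (negPf (xa _ lt_0)).
Qed.

Let beta_add i j u : (j < N)%N -> beta i (u + U_(a j))%MM = beta i u.
Proof.
move=> lt_j; apply: beta_indep => x xa.
by rewrite mnmDE mnm1E eq_sym (negPf (xa _ lt_j)) addn0.
Qed.

Let sum_beta_up j u w :
  (\sum_(i < j.+1) ~~ beta i (u + w)%MM <= \sum_(i < j.+1) ~~ beta i u)%N.
Proof.
apply: leq_sum => i _; case bu : (beta i u) => /=; last exact: leq_b1.
by rewrite beta_up.
Qed.

Let a_neq i j : (i < N)%N -> (j < N)%N -> i <> j -> a i != a j.
Proof. by move=> lt_i lt_j nij; apply/eqP => /(a_inj lt_i lt_j). Qed.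

Lemma glue_identification D t (phi : {rmorphism S -> S}) j :
  (forall i, (i < N)%N -> D (a i)) ->
  identification J D t phi (glue_mnm 0) -> (j < N)%N ->
  exists phi' : {rmorphism S -> S},
    identification J (fun x => D x /\ forall l, (0 < l <= j)%N -> x <> a l)
      (t ++ [seq 'X_(a l) - 'X_(a 0) | l <- iota 1 j]) phi' (glue_mnm j).
Proof.
move=> Da st; elim: j => [|j IH] lt_j.
  by exists phi; rewrite cats0; apply: identification_weaken st => i [].
have lt_0 : (0 < N)%N by lia.
have [|phi' st'] := IH; first lia.
have nc0 : a j.+1 != a 0 by apply: a_neq.
have n0c : a 0 != a j.+1 by rewrite eq_sym.
exists (var_subst (a j.+1) (a 0) \o phi').
rewrite -[j.+1]addn1 iotaD add1n addn1 map_cat catA cats1.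
apply: (@identification_weaken (fun x =>
  (D x /\ forall l, (0 < l <= j)%N -> x <> a l) /\ x <> a j.+1)).
  move=> i [Di ia]; split; last by apply: ia; lia.
  by split=> // l lt_l; apply: ia; lia.
(* The first part omits factor [j.+1], the only one to involve [a j.+1]; the second keeps the
   factors beyond [j], none of which involves [a 0]. *)
apply: (@identification_step _ _ _ idJ _ _ _ (glue_mnm j) (glue_mnm j.+1)
  (fun u => (e * \sum_(i < j.+1) ~~ beta i u <= u (a 0))%N /\
     forall i, (j.+1 < i < N)%N -> (e <= u (a i))%N || beta i u)
  (fun u => forall i, (j < i < N)%N -> (e <= u (a i))%N || beta i u)) => //.
- by split; [apply: Da | move=> l lt_l; apply/eqP; apply: a_neq; lia].
- by split; [apply: Da | move=> l lt_l; apply/eqP; apply: a_neq; lia].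
- move=> u w [le0 leS]; split=> [|i /leS /orP[le_e|bi]].
  + apply: leq_trans (leq_mul (leqnn e) (sum_beta_up _ _ _)) _.
    by rewrite mnmDE; apply: leq_trans le0 (leq_addr _ _).
  + by rewrite mnmDE (leq_trans le_e) ?leq_addr.
  + by rewrite beta_up ?orbT.
- move=> u w leS i /leS /orP[le_e|bi].
  + by rewrite mnmDE (leq_trans le_e) ?leq_addr.
  + by rewrite beta_up ?orbT.
- move=> u; split=> [[le0 leS]|[[le0 _] leS]]; last by split.
  by split=> //; split=> // i lt_i; apply: leS; lia.
- move=> u [le0 leS]; split=> [|i lt_i].
  + move: le0; rewrite mnmDE mnm1E (negPf nc0) addn0.
    by under eq_bigr => i _ do rewrite beta_add //.
  + have := leS i lt_i; rewrite mnmDE mnm1E beta_add //.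
    by rewrite (negPf (_ : a j.+1 != a i)) ?addn0 //; apply: a_neq; lia.
- move=> u leS i lt_i; have := leS i lt_i; rewrite mnmDE mnm1E beta_add //.
  by rewrite (negPf (_ : a 0 != a i)) ?addn0 //; apply: a_neq; lia.
- move=> u w [le0 leS]; split=> [|i /leS /orP[le_e|bi]].
  + apply: leq_trans (leq_mul (leqnn e) (sum_beta_up _ _ _)) _.
    by rewrite mnmDE; apply: leq_trans le0 (leq_addr _ _).
  + by rewrite mnmDE (leq_trans le_e) ?leq_addr.
  + by rewrite beta_up ?orbT.
- move=> u [le0 leS]; split=> [|i lt_i].
  + under eq_bigr => i _ do rewrite beta_merge //.
    rewrite mnmE (negPf n0c) eqxx big_ord_recr /= mulnDr addnC.
    have lt1 : (j < j.+1 < N)%N by lia.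
    have /orP[le_e|->] := leS j.+1 lt1; last by rewrite /= muln0 (leq_trans le0) ?leq_addl.
    by apply: leq_add => //; apply: leq_trans le_e; case: (beta _ _) => /=; lia.
  + rewrite beta_merge // mnmE.
    have /negPf -> : a i != a j.+1 by apply: a_neq; lia.
    have /negPf -> : a i != a 0 by apply: a_neq; lia.
    by apply: leS; lia.
- move=> v [le0 leS]; move: le0; rewrite big_ord_recr /= mulnDr.
  have [bj | nbj] := boolP (beta j.+1 v) => le0.
    exists v => //; split; first by move: le0; rewrite muln0 addn0.
    move=> i lt_i; have [-> | nij] := eqVneq i j.+1; first by rewrite bj orbT.
    by apply: leS; lia.
  rewrite muln1 in le0.
  (* Factor [j.+1] is paid for by [e] copies of [a 0], which are handed back to [a j.+1]. *)
  have [|w mw [wc w0 wi]] := @mnm_merge_move (a j.+1) (a 0) v e nc0; first lia.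
  have bw i : beta i w = beta i v.
    by apply: beta_indep => x xa; apply: wi; apply: xa.
  exists w => //; split.
    under eq_bigr => i _ do rewrite bw.
    have le_e : (e <= v (a 0))%N by apply: leq_trans le0; rewrite leq_addl.
    by rewrite w0 -(leq_add2r e) subnK.
  move=> i lt_i; have [-> | nij] := eqVneq i j.+1; first by rewrite wc leq_addl.
  rewrite bw wi; first by apply: leS; lia.
  - by apply: a_neq; lia.
  - by apply: a_neq; lia.
Qed.

End Glue.

End Sequences.

Section Sequences.
Variables (k : fieldType) (m : nat).
Local Notation S := {mpoly k[m]}.
Implicit Types (u v w : 'X_{1..m}) (c d : 'I_m) (f g h : S) (D : 'I_m -> Prop).
Variables (J : S -> Prop) (idJ : ideal_closed J).

Section Depolarize.
Variables (n : nat) (x x' : nat -> 'I_m).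
Hypothesis x_inj : forall i j, (i < n + n)%N -> (j < n + n)%N -> x i = x j -> i = j.
Hypothesis x'_inj : forall i j, (i < n + n)%N -> (j < n + n)%N -> x' i = x' j -> i = j.
Hypothesis xx' : forall i j, (i < n + n)%N -> (j < n + n)%N -> x i <> x' j.

(** [P] is the condition on the pair in transit: both variables, only one of them, or the square of
    [x j] after the identification. *)
Definition factor_mnm j (P : pred 'X_{1..m}) l u : bool :=
  if (l < j)%N then (1 < u (x l))%N
  else if l == j then P u else (0 < u (x l))%N && (0 < u (x' l))%N.

Definition product_mnm j P u : Prop :=
  forall i, (i < n)%N -> factor_mnm j P i u || factor_mnm j P (n + i) u.

(* The monomials of [\prod_(i < n) (x_i x'_i, x_(n+i) x'_(n+i))]; [factor_mnm]
   describes the stage at which [x'_l] is identified with [x_l] for [l < j]. *)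
Definition polarized_mnm u : Prop := forall i, (i < n)%N ->
  (0 < u (x i))%N && (0 < u (x' i))%N || (0 < u (x (n + i)))%N && (0 < u (x' (n + i)))%N.

Let product_mnm_sub j P Q u v :
  (forall l, (l < n + n)%N -> factor_mnm j P l u -> factor_mnm j Q l v) ->
  product_mnm j P u -> product_mnm j Q v.
Proof.
move=> PQ Pu i lt_i; have /orP[Pi|Pi] := Pu i lt_i; apply/orP; [left|right];
by apply: PQ Pi; lia.
Qed.

Let square j : pred 'X_{1..m} := fun u => (1 < u (x j))%N.
Let pol j : pred 'X_{1..m} := fun u => (0 < u (x j))%N && (0 < u (x' j))%N.

Let squareE j l u : factor_mnm j (square j) l u = factor_mnm j.+1 (pol j.+1) l u.
Proof.
rewrite /factor_mnm ltnS; have [lt_l|lt_l|->] := ltngtP l j => //.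
by case: eqP => // ->.
Qed.

Let product_up j (P : pred 'X_{1..m}) : (forall u w, P u -> P (u + w)%MM) ->
  up_closed (product_mnm j P).
Proof.
move=> Pup u w; apply: product_mnm_sub => l _; rewrite /factor_mnm !mnmDE.
by case: ifP => _; [lia | case: ifP => _; [apply: Pup | lia]].
Qed.

Let gt0_up c (r : nat) u w : (r < u c)%N -> (r < (u + w)%MM c)%N.
Proof. by rewrite mnmDE; lia. Qed.

Let x_neq i j : (i < n + n)%N -> (j < n + n)%N -> i <> j -> x i != x j.
Proof. by move=> lt_i lt_j nij; apply/eqP => /(x_inj lt_i lt_j). Qed.
Let x'_neq i j : (i < n + n)%N -> (j < n + n)%N -> i <> j -> x' i != x' j.
Proof. by move=> lt_i lt_j nij; apply/eqP => /(x'_inj lt_i lt_j). Qed.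
Let xx'_neq i j : (i < n + n)%N -> (j < n + n)%N -> x i != x' j.
Proof. by move=> lt_i lt_j; apply/eqP/xx'. Qed.

Let factor_agree j (P Q : pred _) l u v : (j < n + n)%N -> (l < n + n)%N ->
  (P u -> Q v) -> (forall i, i != x j -> i != x' j -> u i = v i) ->
  factor_mnm j P l u -> factor_mnm j Q l v.
Proof.
move=> lt_j lt_l PQ uv; rewrite /factor_mnm.
have [lt_lj|lt_jl|_] := ltngtP l j; last exact: PQ.
- rewrite uv //; first by apply: x_neq; lia.
  by apply: xx'_neq; lia.
- rewrite !uv //; rewrite ?(x_neq, x'_neq, xx'_neq) //; try lia.
  by rewrite eq_sym xx'_neq.
Qed.

Lemma depolarize_identification j : (j <= n + n)%N ->
  (forall f, J f <-> monomial_ideal polarized_mnm f) ->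
  exists phi : {rmorphism S -> S},
    identification J (fun z => forall l, (l < j)%N -> z <> x' l)
      [seq 'X_(x' l) - 'X_(x l) | l <- iota 0 j] phi
      (product_mnm j (pol j)).
Proof.
move=> le_j JE; elim: j le_j => [_|j IH lt_j].
  exists idfun; apply: (identification_start idJ).
    by apply: product_up => u w /andP[? ?]; rewrite /pol !gt0_up.
  move=> f; rewrite JE; apply: eq_monomial_ideal => u.
  rewrite /product_mnm /factor_mnm /polarized_mnm /pol /=.
  by split=> H i /H; do 2! [case: eqP => [->|_] //].
have [|phi st] := IH; first lia.
have ncd : x' j != x j by rewrite eq_sym xx'_neq.
exists (var_subst (x' j) (x j) \o phi).
rewrite -[j.+1]addn1 iotaD add0n addn1 map_cat cats1.
apply: (@identification_weaken _ _ J (fun z => (forall l, (l < j)%N -> z <> x' l) /\ z <> x' j)).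
  by move=> z zx; split=> [l lt_l|]; apply: zx; lia.
(* With [x_j x'_j] in place [j] the ideal is the intersection of those with [x_j] and with [x'_j]
   there. *)
apply: (@identification_step _ _ _ idJ _ _ _ (product_mnm j (pol j))
  (product_mnm j.+1 (pol j.+1)) (product_mnm j (fun u => 0 < u (x j))%N)
  (product_mnm j (fun u => 0 < u (x' j))%N)) => //.
- by move=> l lt_l; apply/eqP; apply: x'_neq; lia.
- by move=> l lt_l; apply: xx'; lia.
- by apply: product_up => u w; apply: gt0_up.
- by apply: product_up => u w; apply: gt0_up.
- move=> u; split=> [Eu|[E1 E2] i lt_i].
    by split; apply: product_mnm_sub Eu => l lt_l; apply: factor_agree => // /andP[].
  have fE (P Q : pred 'X_{1..m}) l : l != j -> factor_mnm j P l u = factor_mnm j Q l u.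
    by rewrite /factor_mnm => /negPf ->.
  have fI l : factor_mnm j (fun u => 0 < u (x j))%N l u ->
      factor_mnm j (fun u => 0 < u (x' j))%N l u -> factor_mnm j (pol j) l u.
    by rewrite /factor_mnm /pol; have [] := ltngtP l j => // _ -> ->.
  have := E1 i lt_i; have := E2 i lt_i.
  have [ij | nij] := eqVneq i j.
    have nj : (n + i)%N != j by lia.
    rewrite !(fE _ (pol j) _ nj); case: (factor_mnm _ _ (n + i) _) => //=; first by rewrite !orbT.
    by rewrite !orbF => ? ?; apply: fI.
  rewrite !(fE _ (pol j) _ nij); case: (factor_mnm _ _ i _) => //= ? ?.
  exact: fI.
- move=> u; apply: product_mnm_sub => l lt_l; rewrite /factor_mnm !mnmDE !mnm1E.
  have [l1|l1|_] := ltngtP l j.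
  + have /negPf -> : x' j != x l by rewrite eq_sym; apply: xx'_neq.
    by rewrite addn0.
  + have /negPf -> : x' j != x l by rewrite eq_sym; apply: xx'_neq.
    have /negPf -> : x' j != x' l by apply: x'_neq => //; lia.
    by rewrite !addn0.
  + by rewrite (negPf ncd) addn0.
- move=> u; apply: product_mnm_sub => l lt_l; rewrite /factor_mnm !mnmDE !mnm1E.
  have [l1|l1|_] := ltngtP l j.
  + have /negPf -> : x j != x l by apply: x_neq => //; lia.
    by rewrite addn0.
  + have /negPf -> : x j != x l by apply: x_neq => //; lia.
    have /negPf -> : x j != x' l by apply: xx'_neq.
    by rewrite !addn0.
  + by rewrite eq_sym (negPf ncd) addn0.
- by apply: product_up => u w /andP[? ?]; rewrite /pol !gt0_up.
- move=> u Eu i lt_i; rewrite -!squareE.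
  move: i lt_i; apply: (product_mnm_sub _ Eu) => l lt_l; apply: factor_agree => //.
    by rewrite /pol /square mnmE eq_sym (negPf ncd) eqxx; lia.
  by move=> i ix ix'; rewrite mnmE (negPf ix) (negPf ix').
- move=> v Ev; have {}Ev : product_mnm j (square j) v.
    by move=> i lt_i; rewrite !squareE; apply: Ev.
  (* If the square of [x j] does not divide, every factor is met without the pair [j] and [v] itself
     serves; otherwise one unit goes back to [x' j]. *)
  have [le2 | gt2] := boolP (1 < v (x j))%N; last first.
    exists v => //; apply: product_mnm_sub Ev => l lt_l; apply: factor_agree => //.
    by rewrite /square (negPf gt2).
  have [|w mw [wc wd wi]] := @mnm_merge_move _ (x' j) (x j) v 1 ncd; first lia.
  exists w => //; apply: product_mnm_sub Ev => l lt_l; apply: factor_agree => //.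
    by rewrite /square /pol wc wd; lia.
  by move=> i ix ix'; rewrite wi.
Qed.

End Depolarize.
End Sequences.

(** * Depth from a regular sequence and a socle monomial *)

Section Depth.
Variables (k : fieldType) (m : nat).
Local Notation S := {mpoly k[m]}.

Lemma graded_max_idealP (f : S) : graded_max_ideal f ->
  f \in ideal_gen (fun x => x \in [seq 'X_i | i : 'I_m]).
Proof.
move=> f0; have : monomial_ideal (fun u => u != 0%MM) f.
  by move=> u; apply: contraNneq => ->; rewrite f0.
apply: (@monomial_ideal_ind _ _ _ (fun f => f \in ideal_gen _)).
  exact: ideal_genP.
move=> u u0; have [i ui] : exists i, u i != 0%N.
  apply/existsP; apply: contraR u0 => /existsPn u0; apply/eqP/mnmP => i.
  by rewrite mnm0E; have /negPn/eqP := u0 i.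
have le_u : (U_(i) <= u)%MM by rewrite lep1mP.
rewrite -(submK le_u) mpolyXD; have [_ _ M] := ideal_genP (fun x : S => x \in [seq 'X_i | i : 'I_m]).
by apply: M; apply: mem_ideal_gen; apply: map_f; rewrite mem_enum.
Qed.

Lemma quot_depth (G J : S -> Prop) (t : seq S) w :
  ideal_closed J -> (forall f, f \in ideal_gen G <-> J f) ->
  regular_mod J t -> {in t, forall f, graded_max_ideal f} ->
  ~ ideal_add J t w -> (forall i, ideal_add J t ('X_i * w)) ->
  is_depth (quot_ideal G) graded_max_ideal (size t).
Proof.
move=> idJ GJ regt tm nw Xw.
have addE s f : in_ideal_mul s (quot_pi G f) <-> ideal_add J s f.
  rewrite in_ideal_mulP.
  by split=> -[c]; exists c; apply/GJ.
have scaleE a (x : quot_ideal G) : a *: x = quot_pi G (a * quot_repr x) by [].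
split=> [|s sm [regs _]].
  exists t; split=> //; split=> [i x lt_i|]; last by exists (quot_pi G w); rewrite addE.
  by rewrite scaleE addE -[x in in_ideal_mul _ x]quot_reprK addE; apply: regt.
apply: (@regular_mod_size _ J [seq 'X_i | i : 'I_m] _ _ w) => //.
- by move=> x /mapP[i _ ->].
- move=> i f lt_i; have := regs i (quot_pi G f) lt_i.
  by rewrite [_ *: _]scale_quot_pi !addE.
- by move=> f /sm /graded_max_idealP.
Qed.

Lemma graded_max_ideal_XB (c d : 'I_m) : graded_max_ideal ('X_c - 'X_d : S).
Proof. by rewrite /graded_max_ideal mcoeffB !mcoeffX !mnm1_eq0 subrr. Qed.

Section GlueDepth.
Variables (J : S -> Prop) (idJ : ideal_closed J).
Variables (N e : nat) (a : nat -> 'I_m) (beta : nat -> 'X_{1..m} -> bool).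
Hypotheses (N_gt0 : (0 < N)%N) (e_gt0 : (0 < e)%N).
Hypothesis a_inj : forall i j, (i < N)%N -> (j < N)%N -> a i = a j -> i = j.
Hypothesis beta_up : forall i u w, beta i u -> beta i (u + w)%MM.
Hypothesis beta_indep : forall i (u v : 'X_{1..m}),
  (forall x, (forall j, (j < N)%N -> x != a j) -> u x = v x) -> beta i u = beta i v.

(** The exponent [e * N - 1] of [a 0] in [w] is one short of paying for all [N] factors, so [w] lies
    outside the ideal and one more [a 0] brings it in. A variable that meets some [beta i] leaves at
    most [N - 1] factors to pay, at a cost of [e * (N - 1)], which is available since [e > 0]. By
    [cover], every variable is congruent to one of these kinds. *)
Lemma glue_depth (G : S -> Prop) D t (phi : {rmorphism S -> S}) (w : 'X_{1..m}) :
  (forall f, f \in ideal_gen G <-> J f) ->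
  {in t, forall f, graded_max_ideal f} ->
  (forall i, (i < N)%N -> D (a i)) ->
  identification J D t phi (glue_mnm N e a beta 0) ->
  w (a 0) = (e * N).-1 ->
  (forall i, (i < N)%N -> ~~ beta i w) ->
  (forall x, w x != 0%N -> D x /\ forall l, (0 < l < N)%N -> x <> a l) ->
  (forall x, exists2 y, ideal_add J t ('X_x - 'X_y) &
    (exists2 l, (l < N)%N & y = a l) \/ exists2 i, (i < N)%N & beta i (w + U_(y))%MM) ->
  is_depth (quot_ideal G) graded_max_ideal (size t + N.-1).
Proof.
move=> GJ tm Da st wa wb wD cover.
have lt_N : (N.-1 < N)%N by lia.
have [phi' st'] := glue_identification idJ a_inj beta_up beta_indep Da st lt_N.
set t' := t ++ _ in st'.
have -> : (size t + N.-1 = size t')%N by rewrite size_cat size_map size_iota.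
have [V0 VD VM] := ideal_add_closed t' idJ.
have sum_le (u : 'X_{1..m}) : (\sum_(i < N) ~~ beta i u <= N)%N.
  rewrite -[X in (_ <= X)%N](card_ord N) -sum1_card.
  by apply: leq_sum => i _; apply: leq_b1.
have glueE u : glue_mnm N e a beta N.-1 u <-> (e * \sum_(i < N) ~~ beta i u <= u (a 0))%N.
  rewrite /glue_mnm prednK //; split=> [[] //|]; split=> // i lt_i; lia.
have Xa0 : ideal_add J t' ('X_(a 0) * 'X_[w]).
  rewrite -mpolyXD; apply: (id_mnm st'); apply/glueE.
  rewrite mnmDE mnm1E eqxx wa add1n prednK ?muln_gt0 ?e_gt0 // leq_mul2l.
  by rewrite sum_le orbT.
apply: (quot_depth (J := J) (w := 'X_[w])) => //.
- exact: (id_regular st').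
- move=> f; rewrite mem_cat => /orP[/tm //|/mapP[l _ ->]].
  exact: graded_max_ideal_XB.
- move/(id_iff idJ _ st'); rewrite rmorph_mpolyX_fixed => [|x /wD[Dx xa]].
    move/monomial_idealX/glueE; rewrite wa.
    rewrite (eq_bigr (fun=> 1%N)) => [|i _]; last by rewrite wb.
    by rewrite sum1_card card_ord => le_eN; have := muln_gt0 e N; rewrite e_gt0 N_gt0; lia.
  by apply: (id_fixed st'); split=> // l lt_l; apply: xa; lia.
- move=> x; have [y xy yP] := cover x.
  have tt f : ideal_add J t f -> ideal_add J t' f.
    apply: ideal_add_min => [|g|g gt]; first exact: ideal_add_closed.
      exact: ideal_add_sub.
    by apply: ideal_add_mem; rewrite // mem_cat gt.
  suff Vy : ideal_add J t' ('X_y * 'X_[w]).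
    rewrite -['X_x](subrK 'X_y) mulrDl; apply: VD => //.
    by rewrite mulrC; apply: VM; apply: tt.
  case: yP => [[l lt_l ->] | [i lt_i bi]].
    have [-> // | l0] := eqVneq l 0%N.
    rewrite -['X_(a l)](subrK 'X_(a 0)) mulrDl; apply: VD => //.
    rewrite mulrC; apply: VM; apply: ideal_add_mem => //.
    rewrite mem_cat; apply/orP; right; apply/mapP; exists l => //.
    by rewrite mem_iota; lia.
  rewrite mulrC -mpolyXD; apply: (id_mnm st'); apply/glueE.
  rewrite (bigD1 (Ordinal lt_i)) //= bi add0n.
  apply: (@leq_trans (e * N.-1)%N); last first.
    rewrite mnmDE wa; apply: leq_trans (leq_addr _ _).
    by case: N N_gt0 e_gt0 => // N' _ e0; rewrite /= mulnS; lia.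
  rewrite leq_mul2l; apply/orP; right.
  apply: (@leq_trans (\sum_(j < N | j != Ordinal lt_i) 1)); first by apply: leq_sum => j _; apply: leq_b1.
  rewrite sum1_card; have := cardC1 (Ordinal lt_i); rewrite card_ord => <-.
  by apply: eq_leq; apply: eq_card.
Qed.
End GlueDepth.

Lemma polarized_depth (G J : S -> Prop) n (x x' : nat -> 'I_m) :
  (0 < n)%N -> ideal_closed J -> (forall f, f \in ideal_gen G <-> J f) ->
  (forall f, J f <-> monomial_ideal (polarized_mnm n x x') f) ->
  (forall i j, (i < n + n)%N -> (j < n + n)%N -> x i = x j -> i = j) ->
  (forall i j, (i < n + n)%N -> (j < n + n)%N -> x' i = x' j -> i = j) ->
  (forall i j, (i < n + n)%N -> (j < n + n)%N -> x i <> x' j) ->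
  (forall z, exists2 l, (l < n + n)%N & z = x l \/ z = x' l) ->
  is_depth (quot_ideal G) graded_max_ideal (n + n + n.-1).
Proof.
move=> n_gt0 idJ GJ JE x_inj x'_inj xx' cover.
have [phi st] := depolarize_identification idJ x_inj x'_inj xx' (leqnn _) JE.
(* After depolarization the factors are [(x_i^2, x_(n+i)^2)]. The guard keeps [beta] independent of
   the glued variables for [i] out of range too. *)
pose beta i (u : 'X_{1..m}) := (i < n)%N && (1 < u (x (n + i)))%N.
(* The socle monomial is [x_0^(2n-1)] times all [x_(n+i)]. *)
pose w : 'X_{1..m} := [multinom if z == x 0 then (2 * n).-1 else
  nat_of_bool [exists i : 'I_n, z == x (n + i)%N] | z < m].
have w0 : w (x 0) = (2 * n).-1 by rewrite mnmE eqxx.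
have wn i : (i < n)%N -> w (x (n + i)) = 1%N.
  move=> lt_i; rewrite mnmE.
  have /negPf -> : x (n + i) != x 0 by apply/eqP => /x_inj; lia.
  by have -> : [exists j : 'I_n, x (n + i) == x (n + j)%N] by apply/existsP; exists (Ordinal lt_i).
pose t := [seq 'X_(x' l) - 'X_(x l) : S | l <- iota 0 (n + n)].
have tx l : (l < n + n)%N -> ideal_add J t ('X_(x' l) - 'X_(x l)).
  move=> lt_l; apply: ideal_add_mem => //; apply/mapP; exists l => //.
  by rewrite mem_iota.
have -> : (n + n = size t)%N by rewrite size_map size_iota.
apply: (@glue_depth J idJ n 2 x beta _ _ _ _ _ G
  (fun z => forall l, (l < n + n)%N -> z <> x' l) t phi w) => //.
- by move=> i j lt_i lt_j; apply: x_inj; lia.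
- by move=> i u v; rewrite /beta mnmDE; lia.
- move=> i u v uv; rewrite /beta; case: (ltnP i n) => //= lt_i; rewrite uv // => j lt_j.
  by apply/eqP => /x_inj; lia.
- by move=> f /mapP[l _ ->]; apply: graded_max_ideal_XB.
- by move=> i lt_i l lt_l; apply: xx'; lia.
(* At stage [n + n] all pairs are squares: the predicate at index [n + n] is never consulted. *)
- have -> : glue_mnm n 2 x beta 0 =
      product_mnm n x x' (n + n) (fun u => (0 < u (x (n + n)))%N && (0 < u (x' (n + n)))%N).
    apply/funext => u; apply/propext.
    have fE l : (l < n + n)%N -> factor_mnm x x' (n + n)
      (fun u => (0 < u (x (n + n)))%N && (0 < u (x' (n + n)))%N) l u = (1 < u (x l))%N.
      by rewrite /factor_mnm => ->.
    have bE i : (i < n)%N -> beta i u = (1 < u (x (n + i)))%N by rewrite /beta => ->.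
    split=> [[le0 leS] i lt_i | Eu].
      rewrite !fE; [|lia|lia]; rewrite -bE //.
      have [i0 | i0] := eqVneq i 0%N; last by apply: leS; lia.
      by move: le0; rewrite i0 big_ord1; case: (beta 0 u) => /=; rewrite ?orbT //; lia.
    split=> [|i /andP[i0 lt_i]]; last first.
      by rewrite bE //; have := Eu i lt_i; rewrite !fE //; lia.
    rewrite big_ord1 /= bE //; have := Eu 0%N n_gt0; rewrite !fE; [|lia|lia].
    by case: (1 < u (x (n + 0)%N))%N; rewrite ?orbF /=; lia.
  exact: st.
- by move=> i lt_i; rewrite /beta lt_i wn.
- move=> z; rewrite mnmE; have [-> _ | _] := eqVneq z (x 0).
    split=> [l lt_l | l lt_l]; first by apply: xx'; lia.
    by move/x_inj; lia.
  case: existsP => // -[i /eqP ->] _; have lt_i := ltn_ord i; split=> [l lt_l | l lt_l].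
    by apply: xx'; lia.
  by move/x_inj; lia.
- move=> z; have [l lt_l zl] := cover z; exists (x l).
    case: zl => ->; last exact: tx.
    by rewrite subrr; case: (ideal_add_closed t idJ).
  have [lt_ln | le_nl] := ltnP l n; first by left; exists l.
  right; exists (l - n)%N; first lia.
  have ll : (n + (l - n) = l)%N by lia.
  have w1 : w (x l) = 1%N by rewrite -ll wn //; lia.
  by rewrite /beta mnmDE mnm1E ll eqxx w1 andbT; lia.
Qed.

Definition marked_pairs_mnm n (v : nat -> 'I_m) (u : 'X_{1..m}) : Prop :=
  (forall i, (i <= n)%N -> (0 < u (v i))%N) /\
  forall i, (n < i < 2 * n + 1)%N -> (0 < u (v i))%N || (0 < u (v (n + i)))%N.

Lemma marked_pairs_depth (G J : S -> Prop) n (v : nat -> 'I_m) :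
  ideal_closed J -> (forall f, f \in ideal_gen G <-> J f) ->
  (forall f, J f <-> monomial_ideal (marked_pairs_mnm n v) f) ->
  (forall i j, (i < 3 * n + 1)%N -> (j < 3 * n + 1)%N -> v i = v j -> i = j) ->
  (forall z, exists2 l, (l < 3 * n + 1)%N & z = v l) ->
  is_depth (quot_ideal G) graded_max_ideal (2 * n).
Proof.
move=> idJ GJ JE v_inj cover.
(* Each marked variable counts as a factor without alternative, so [beta] fails for [i <= n] and
   there are [2 * n + 1] factors. *)
pose beta i (u : 'X_{1..m}) := (n < i < 2 * n + 1)%N && (0 < u (v (n + i)))%N.
(* The socle monomial is [v_0^(2n)], one power short of the number of factors. *)
pose w : 'X_{1..m} := [multinom if z == v 0 then (2 * n)%N else 0%N | z < m].
have wn i : (0 < i < 3 * n + 1)%N -> w (v i) = 0%N.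
  move=> lt_i; rewrite mnmE.
  by have /negPf -> : v i != v 0 by apply/eqP => /v_inj; lia.
have -> : (2 * n = size ([::] : seq S) + (2 * n + 1).-1)%N by rewrite /=; lia.
have E0 : glue_mnm (2 * n + 1) 1 v beta 0 = marked_pairs_mnm n v.
  apply/funext => u; apply/propext; rewrite /glue_mnm big_ord1 /beta ltn0 /=.
  split=> [[le0 leS] | [Ev Ep]]; split.
  - move=> i le_i; have [-> | i0] := eqVneq i 0%N; first lia.
    by have := leS i; rewrite [(n < i)%N]ltnNge le_i /= orbF; apply; lia.
  - by move=> i lt_i; have := leS i; rewrite lt_i /=; apply; lia.
  - by have := Ev 0%N; lia.
  - move=> i lt_i; have [le_i | gt_i] := leqP i n; first by rewrite Ev.
    have -> : (i < 2 * n + 1)%N by lia.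
    by rewrite andbT; apply: Ep; lia.
apply: (@glue_depth J idJ (2 * n + 1) 1 v beta _ _ _ _ _ G
  (fun=> True) [::] idfun w) => //.
- lia.
- by move=> i j lt_i lt_j; apply: v_inj; lia.
- by move=> i u u'; rewrite /beta mnmDE; lia.
- move=> i u u' uu; rewrite /beta; case: (boolP (n < i < 2 * n + 1)%N) => //= lt_i.
  by rewrite uu // => j lt_j; apply/eqP => /v_inj; lia.
- rewrite E0; apply: identification_start => // u u' [Ev Ep]; split=> i lt_i.
    by have := Ev i lt_i; rewrite mnmDE; lia.
  by have := Ep i lt_i; rewrite !mnmDE; lia.
- by rewrite mnmE eqxx; lia.
- move=> i lt_i; rewrite /beta; case: (boolP (n < i < 2 * n + 1)%N) => //= lt_ni.
  by rewrite wn //; lia.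
- move=> z; rewrite mnmE; have [-> _ | //] := eqVneq z (v 0).
  by split=> // l lt_l /v_inj; lia.
- move=> z; exists z; first by rewrite subrr; case: (ideal_add_closed [::] idJ).
  have [l lt_l ->] := cover z.
  have [lt_ln | le_nl] := ltnP l (2 * n + 1); first by left; exists l.
  right; exists (l - n)%N; first lia.
  have ll : (n + (l - n) = l)%N by lia.
  by rewrite /beta mnmDE mnm1E ll eqxx; lia.
Qed.

End Depth.

(** * Generators of the two ideals *)

Lemma squarefree_le m (L : seq 'I_m) (u : 'X_{1..m}) : uniq L ->
  reflect (forall i, i \in L -> (0 < u i)%N) (\sum_(i <- L) U_(i) <= u)%MM.
Proof.
move=> uL; have sumE i : (\sum_(j <- L) U_(j))%MM i = (i \in L).
  rewrite mnm_sumE -(count_uniq_mem i uL) -sum1_count [RHS]big_mkcond /=.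
  by apply: eq_bigr => j _; rewrite mnm1E eq_sym; case: eqP.
apply: (iffP mnm_lepP) => [le_u i iL | le_u i].
  by have := le_u i; rewrite sumE iL.
by rewrite sumE; case: (boolP (i \in L)) => // /le_u.
Qed.

Lemma prod_mpolyX (k : fieldType) m (L : seq 'I_m) :
  \prod_(i <- L) 'X_i = 'X_[\sum_(i <- L) U_(i)] :> {mpoly k[m]}.
Proof. by rewrite -mprodXE. Qed.

Section Generators.
Variables (n : nat) (n_gt0 : (0 < n)%N) (k : fieldType).
Local Notation P := (diamond n).
Variables (el : nat -> P).
Hypothesis elK : forall c, (c < 3 * n + 1)%N -> dcode (el c) = c.

Lemma dcodeK (z : P) : el (dcode z) = z.
Proof. by apply: (dcode_inj n_gt0); rewrite elK ?(dcode_lt n_gt0). Qed.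

Lemma el_inj c d : (c < 3 * n + 1)%N -> (d < 3 * n + 1)%N -> el c = el d -> c = d.
Proof. by move=> lt_c lt_d /(congr1 (@dcode n)); rewrite !elK. Qed.

Lemma chain_code_inj eps i j : chain_code eps i = chain_code eps j -> i = j.
Proof. by move/(congr1 crank); rewrite !crank_chain_code. Qed.

Section Path.
Variables (x : P -> 'I_(3 * n + 1)) (bij_x : bijective x).

(** A renumbering that fits [marked_pairs_mnm]: the elements [3 i] common to all maximal chains,
    then the [3 i + 1], then the [3 i + 2], so that the two middle elements of a diamond are [n]
    apart. *)
Definition path_code i : nat :=
  (if i <= n then 3 * i else if i < 2 * n + 1 then 3 * (i - n.+1) + 1
   else 3 * (i - (2 * n + 1)) + 2)%N.

Definition path_var i := x (el (path_code i)).

Lemma path_code_lt i : (i < 3 * n + 1)%N -> (path_code i < 3 * n + 1)%N.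
Proof. by rewrite /path_code; case: (leqP i n) => ?; case: (ltnP i (2 * n + 1)) => ?; lia. Qed.

Lemma path_code_inj i j : path_code i = path_code j -> i = j.
Proof.
rewrite /path_code; case: (leqP i n) => ?; case: (leqP j n) => ?;
by case: (ltnP i (2 * n + 1)) => ?; case: (ltnP j (2 * n + 1)) => ?; lia.
Qed.

Lemma path_code_surj c : (c < 3 * n + 1)%N -> exists2 i, (i < 3 * n + 1)%N & c = path_code i.
Proof.
have [i [] ->] := code_cases c => lt_c; rewrite /path_code.
- by exists i; [lia | rewrite ifT //; lia].
- by exists (i + n.+1)%N; [lia | rewrite ifF ?ifT; lia].
- by exists (i + (2 * n + 1))%N; [lia | rewrite ifF ?ifF; lia].
Qed.

Lemma path_var_inj i j : (i < 3 * n + 1)%N -> (j < 3 * n + 1)%N ->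
  path_var i = path_var j -> i = j.
Proof.
move=> lt_i lt_j /(bij_inj bij_x) /el_inj; rewrite !path_code_lt //.
by move=> /(_ isT isT) /path_code_inj.
Qed.

Lemma path_var_surj z : exists2 l, (l < 3 * n + 1)%N & z = path_var l.
Proof.
have [x' _ x'K] := bij_x; have [l lt_l cl] := path_code_surj (dcode_lt n_gt0 (x' z)).
by exists l; rewrite // /path_var -cl dcodeK x'K.
Qed.

Lemma path_genE f : f \in ideal_gen (path_gens k (2 * n + 1) x) <->
  monomial_ideal (marked_pairs_mnm n path_var) f.
Proof.
pose L eps := [seq x (el (chain_code eps j)) | j <- iota 0 (2 * n + 1)].
have uL eps : uniq (L eps).
  rewrite map_inj_in_uniq ?iota_uniq // => i j; rewrite !mem_iota !add0n => lt_i lt_j.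
  move/(bij_inj bij_x)/el_inj; rewrite !chain_code_lt //.
  by move=> /(_ isT isT) /chain_code_inj.
have inL eps j : (j < 2 * n + 1)%N -> x (el (chain_code eps j)) \in L eps.
  by move=> lt_j; apply/mapP; exists j; rewrite // mem_iota.
have codeV i : (i <= n)%N -> path_code i = (3 * i)%N by rewrite /path_code => ->.
have codeA i : (i < n)%N -> path_code (n.+1 + i) = (3 * i + 1)%N.
  by move=> lt_i; rewrite /path_code ifF ?ifT; lia.
have codeB i : (i < n)%N -> path_code (n + (n.+1 + i)) = (3 * i + 2)%N.
  by move=> lt_i; rewrite /path_code ifF ?ifF; lia.
have gensE g : path_gens k (2 * n + 1) x g <->
    exists eps, g = 'X_[\sum_(i <- L eps) U_(i)].
  split=> [[s [ss sz ->]] | [eps ->]].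
    have [eps ->] : exists eps, s = mkseq (fun j => el (chain_code eps j)) (2 * n + 1).
      by apply/(full_chainP n_gt0 (el 0%N)).
    by exists eps; rewrite -prod_mpolyX !big_map.
  exists (mkseq (fun j => el (chain_code eps j)) (2 * n + 1)).
  have [_ /(_ (ex_intro _ eps erefl))[ss sz]] :=
    full_chainP n_gt0 (el 0%N) (mkseq (fun j => el (chain_code eps j)) (2 * n + 1)) elK.
  by split=> //; rewrite -prod_mpolyX !big_map.
apply: monomial_ideal_gen.
- move=> u w [uv up]; split=> i lt_i; first by have := uv i lt_i; rewrite mnmDE; lia.
  by have := up i lt_i; rewrite !mnmDE; lia.
- move=> g /gensE[eps ->]; apply/monomial_idealX.
  have le := squarefree_le (\sum_(i <- L eps) U_(i))%MM (uL eps).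
  have {le}gt0 := elimT le (lepm_refl _).
  split=> i lt_i.
    by apply: gt0; rewrite /path_var codeV //; have := inL eps (2 * i)%N; rewrite chain_code_even; apply; lia.
  have iE : i = (n.+1 + (i - n.+1))%N by lia.
  have lt_i' : (i - n.+1 < n)%N by lia.
  have lt_j : (2 * (i - n.+1) + 1 < 2 * n + 1)%N by lia.
  have := gt0 _ (inL eps _ lt_j); rewrite chain_code_odd.
  rewrite iE /path_var codeA // codeB // -iE.
  by case: (eps _) => ->; rewrite ?orbT.
- move=> u [uv up].
  (* The chain takes [3 i + 2] whenever its variable divides [u]; otherwise [u] is divisible by that
     of [3 i + 1]. *)
  pose eps i := (0 < u (path_var (n + (n.+1 + i))))%N.
  exists (\sum_(i <- L eps) U_(i))%MM; first by apply/gensE; exists eps.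
  apply/(squarefree_le _ (uL eps)) => z /mapP[j]; rewrite mem_iota => /andP[_ lt_j] ->.
  have [i [] ji] := parity_cases j; rewrite ji ?chain_code_even ?chain_code_odd.
    by have := uv i; rewrite /path_var codeV; [apply; lia | lia].
  have lt_i : (i < n)%N by lia.
  have := up (n.+1 + i)%N; rewrite /eps; case: ifP => [gt0 _ | _].
    by move: gt0; rewrite /path_var codeB.
  by rewrite orbF /path_var codeA //; apply; lia.
Qed.

End Path.
End Generators.

Lemma mem_zip_behead (T : eqType) (x0 : T) (s : seq T) a b :
  reflect (exists2 j, (j.+1 < size s)%N & (a, b) = (nth x0 s j, nth x0 s j.+1))
    ((a, b) \in zip s (behead s)).
Proof.
have sz : size (zip s (behead s)) = (size s).-1.
  by rewrite size_zip size_behead; apply/minn_idPr; apply: leq_pred.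
apply: (iffP (nthP (x0, x0))); rewrite sz => -[j lt_j].
  rewrite nth_zip_cond sz lt_j nth_behead => <-; exists j => //.
  by lia.
move=> ->; exists j; first by lia.
by rewrite nth_zip_cond sz nth_behead ifT //; lia.
Qed.

Section EdgeGenerators.
Variables (n : nat) (n_gt0 : (0 < n)%N) (k : fieldType).
Local Notation P := (diamond n).
Variables (el : nat -> P).
Hypothesis elK : forall c, (c < 3 * n + 1)%N -> dcode (el c) = c.
Variables (y : hasse_edge P -> 'I_(4 * n)) (bij_y : bijective y).

(* The edges below and above the [l]-th of the [2 n] non-extremal elements,
   where [l] and [n + l] belong to the same diamond. *)
Definition mid_code l : nat := (if l < n then 3 * l + 1 else 3 * (l - n) + 2)%N.
Definition low_code l : nat := (if l < n then 3 * l else 3 * (l - n))%N.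
Definition high_code l : nat := (if l < n then 3 * l.+1 else 3 * (l - n).+1)%N.

Fact edge_count_gt0 : (0 < 4 * n)%N. Proof. by rewrite muln_gt0. Qed.

(** Total on pairs of codes for convenience; the default is a dummy, as the function is evaluated
    through [edge_varE] on edges only. *)
Definition edge_var c d : 'I_(4 * n) :=
  if [pick e : hasse_edge P | val e == (el c, el d)] is Some e then y e
  else Ordinal edge_count_gt0.

Definition low_var l := edge_var (low_code l) (mid_code l).
Definition high_var l := edge_var (mid_code l) (high_code l).

Lemma edge_varE (e : hasse_edge P) c d : val e = (el c, el d) -> edge_var c d = y e.
Proof.
move=> eE; rewrite /edge_var; case: pickP => [e' /eqP e'E | /(_ e)]; last by rewrite eE eqxx.
by congr y; apply: val_inj; rewrite e'E eE.
Qed.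

Lemma edge_exists c d : (c < 3 * n + 1)%N -> (d < 3 * n + 1)%N -> ccovers c d ->
  exists e : hasse_edge P, val e = (el c, el d).
Proof.
move=> lt_c lt_d cd; have cov : covers (el c, el d).1 (el c, el d).2.
  by rewrite (dcode_covers n_gt0) !elK.
by exists (Sub (el c, el d) cov); rewrite SubK.
Qed.

Lemma code_lt l : (l < n + n)%N -> [/\ (low_code l < 3 * n + 1)%N,
  (mid_code l < 3 * n + 1)%N & (high_code l < 3 * n + 1)%N].
Proof.
by move=> lt_l; rewrite /low_code /mid_code /high_code; case: (ltnP l n) => ?; split; lia.
Qed.

Lemma code_covers l : ccovers (low_code l) (mid_code l) && ccovers (mid_code l) (high_code l).
Proof.
by rewrite /low_code /mid_code /high_code; case: (ltnP l n) => _; rewrite !ccoversE !eqxx ?orbT.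
Qed.

Lemma low_edge l : (l < n + n)%N -> exists2 e : hasse_edge P,
  val e = (el (low_code l), el (mid_code l)) & low_var l = y e.
Proof.
move=> /code_lt[lt_lo lt_mi lt_hi]; have /andP[cov _] := code_covers l.
by have [e eE] := edge_exists lt_lo lt_mi cov; exists e => //; apply: edge_varE.
Qed.

Lemma high_edge l : (l < n + n)%N -> exists2 e : hasse_edge P,
  val e = (el (mid_code l), el (high_code l)) & high_var l = y e.
Proof.
move=> /code_lt[lt_lo lt_mi lt_hi]; have /andP[_ cov] := code_covers l.
by have [e eE] := edge_exists lt_mi lt_hi cov; exists e => //; apply: edge_varE.
Qed.

Lemma mid_code_inj i j : mid_code i = mid_code j -> i = j.
Proof.
by rewrite /mid_code; case: (ltnP i n) => ?; case: (ltnP j n) => ?; lia.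
Qed.

Lemma low_mid_neq i j : low_code i <> mid_code j.
Proof.
by rewrite /low_code /mid_code; case: (ltnP i n) => ?; case: (ltnP j n) => ?; lia.
Qed.

Lemma low_var_inj i j : (i < n + n)%N -> (j < n + n)%N -> low_var i = low_var j -> i = j.
Proof.
move=> lt_i lt_j; have [e eE ->] := low_edge lt_i; have [f fE ->] := low_edge lt_j.
move=> /(bij_inj bij_y) ef; move: eE; rewrite ef fE => -[_ /(el_inj elK)].
have [_ lt_mi _] := code_lt lt_i; have [_ lt_mj _] := code_lt lt_j.
by move=> /(_ lt_mj lt_mi) /mid_code_inj.
Qed.

Lemma high_var_inj i j : (i < n + n)%N -> (j < n + n)%N -> high_var i = high_var j -> i = j.
Proof.
move=> lt_i lt_j; have [e eE ->] := high_edge lt_i; have [f fE ->] := high_edge lt_j.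
move=> /(bij_inj bij_y) ef; move: eE; rewrite ef fE => -[/(el_inj elK) + _].
have [_ lt_mi _] := code_lt lt_i; have [_ lt_mj _] := code_lt lt_j.
by move=> /(_ lt_mj lt_mi) /mid_code_inj.
Qed.

Lemma low_high_neq i j : (i < n + n)%N -> (j < n + n)%N -> low_var i <> high_var j.
Proof.
move=> lt_i lt_j; have [e eE ->] := low_edge lt_i; have [f fE ->] := high_edge lt_j.
move=> /(bij_inj bij_y) ef; move: eE; rewrite ef fE => -[/(el_inj elK) + _].
have [lt_li _ _] := code_lt lt_i; have [_ lt_mj _] := code_lt lt_j.
by move=> /(_ lt_mj lt_li) /esym /low_mid_neq.
Qed.

(** Every edge has exactly one middle end: the upper one if the lower code is divisible by 3, the
    lower one otherwise. *)
Lemma edge_var_surj z : exists2 l, (l < n + n)%N & z = low_var l \/ z = high_var l.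
Proof.
have [y' _ y'K] := bij_y; rewrite -(y'K z); move: (y' z) => e.
have := valP e; case eE : (val e) => [a b] /=.
rewrite (dcode_covers n_gt0) -(dcodeK n_gt0 elK a) -(dcodeK n_gt0 elK b).
have lt_a := dcode_lt n_gt0 a; have lt_b := dcode_lt n_gt0 b.
rewrite !elK // => ab; move: eE; rewrite -{1}(dcodeK n_gt0 elK a) -{1}(dcodeK n_gt0 elK b).
move: (dcode a) (dcode b) lt_a lt_b ab => c d lt_c lt_d + eE.
have [i [] ci] := code_cases c; rewrite ci ccoversE.
all: have ni : (n + i < n)%N = false by lia.
- move=> /orP[]/eqP di; have lt_i : (i < n)%N by lia.
    exists i; first by lia.
    by left; rewrite -(edge_varE eE) /low_var /low_code /mid_code ci di lt_i.
  exists (n + i)%N; first by lia.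
  by left; rewrite -(edge_varE eE) /low_var /low_code /mid_code ci di ni addKn.
- move=> /eqP di; have lt_i : (i < n)%N by lia.
  exists i; first by lia.
  by right; rewrite -(edge_varE eE) /high_var /mid_code /high_code ci di lt_i.
- move=> /eqP di; exists (n + i)%N; first by lia.
  by right; rewrite -(edge_varE eE) /high_var /mid_code /high_code ci di ni addKn.
Qed.

Lemma LD_genE f : f \in ideal_gen (LD_gens k y) <->
  monomial_ideal (polarized_mnm n low_var high_var) f.
Proof.
pose ch eps := mkseq (fun j => el (chain_code eps j)) (2 * n + 1).
pose L (s : seq P) := [seq y e | e <- [seq e <- index_enum _ | edge_of_chain s e]].
have uL s : uniq (L s).
  by rewrite map_inj_uniq ?filter_uniq ?index_enum_uniq //; apply: bij_inj.
have inL eps z : reflect (exists2 e : hasse_edge P, y e = z &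
    exists2 j, (j < 2 * n)%N & val e = (el (chain_code eps j), el (chain_code eps j.+1)))
    (z \in L (ch eps)).
  have memE (e : hasse_edge P) : reflect (exists2 j, (j < 2 * n)%N &
      val e = (el (chain_code eps j), el (chain_code eps j.+1))) (edge_of_chain (ch eps) e).
    rewrite /edge_of_chain; case eE : (val e) => [a b].
    apply: (iffP (mem_zip_behead (el 0%N) _ _ _)); rewrite size_mkseq => -[j lt_j ->]; exists j;
      by [lia | rewrite !nth_mkseq //; lia].
  apply: (iffP mapP) => [[e] | [e <- eP]].
    by rewrite mem_filter => /andP[/memE eP _] ->; exists e.
  by exists e => //; rewrite mem_filter mem_index_enum andbT; apply/memE.
have gensE g : LD_gens k y g <-> exists eps, g = 'X_[\sum_(i <- L (ch eps)) U_(i)].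
  split=> [[s /(maximal_saturatedP n_gt0 (el 0%N)) + ->] | [eps ->]].
    move=> /(full_chainP n_gt0 (el 0%N) _ elK)[eps ->]; exists eps.
    by rewrite -prod_mpolyX big_map big_filter.
  exists (ch eps).
    apply/(maximal_saturatedP n_gt0 (el 0%N))/(full_chainP n_gt0 (el 0%N) _ elK).
    by exists eps.
  by rewrite -prod_mpolyX big_map big_filter.
have midA i : (i < n)%N -> [/\ low_code i = (3 * i)%N, mid_code i = (3 * i + 1)%N
    & high_code i = (3 * i.+1)%N].
  by move=> lt_i; rewrite /low_code /mid_code /high_code lt_i.
have midB i : [/\ low_code (n + i) = (3 * i)%N, mid_code (n + i) = (3 * i + 2)%N
    & high_code (n + i) = (3 * i.+1)%N].
  have ni : (n + i < n)%N = false by lia.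
  by rewrite /low_code /mid_code /high_code ni addKn.
(* The index of the middle element through which the chain passes in diamond [i]. *)
pose idx eps i : nat := if eps i then (n + i)%N else i : nat.
have lt_idx (eps : nat -> bool) i : (i < n)%N -> (idx eps i < n + n)%N.
  by move=> lt_i; rewrite /idx; case: (eps i); lia.
have lowE eps i : (i < n)%N -> (el (chain_code eps (2 * i)), el (chain_code eps (2 * i).+1)) =
    (el (low_code (idx eps i)), el (mid_code (idx eps i))).
  move=> lt_i; rewrite -[(2 * i).+1]addn1 chain_code_even chain_code_odd /idx.
  have [lA mA hA] := midA i lt_i; have [lB mB hB] := midB i.
  by case: (eps i); rewrite ?lA ?mA ?lB ?mB.
have highE eps i : (i < n)%N -> (el (chain_code eps (2 * i + 1)), el (chain_code eps (2 * i + 1).+1)) =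
    (el (mid_code (idx eps i)), el (high_code (idx eps i))).
  move=> lt_i; have -> : (2 * i + 1).+1 = (2 * i.+1)%N by lia.
  rewrite chain_code_even chain_code_odd /idx.
  have [lA mA hA] := midA i lt_i; have [lB mB hB] := midB i.
  by case: (eps i); rewrite ?hA ?mA ?hB ?mB.
apply: monomial_ideal_gen.
- by move=> u w up i lt_i; have := up i lt_i; rewrite !mnmDE; lia.
- move=> g /gensE[eps ->]; apply/monomial_idealX => i lt_i.
  have le := squarefree_le (\sum_(i <- L (ch eps)) U_(i))%MM (uL (ch eps)).
  have {le}gt0 := elimT le (lepm_refl _).
  have [e eE le] := low_edge (lt_idx eps i lt_i).
  have [e' e'E he] := high_edge (lt_idx eps i lt_i).
  have l_gt0 : (0 < (\sum_(i <- L (ch eps)) U_(i))%MM (low_var (idx eps i)))%N.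
    apply: gt0; apply/inL; exists e => //; exists (2 * i)%N; first lia.
    by rewrite lowE.
  have h_gt0 : (0 < (\sum_(i <- L (ch eps)) U_(i))%MM (high_var (idx eps i)))%N.
    apply: gt0; apply/inL; exists e' => //; exists (2 * i + 1)%N; first lia.
    by rewrite highE.
  by move: l_gt0 h_gt0; rewrite /idx; case: (eps i) => -> ->; rewrite ?orbT.
- move=> u up.
  pose eps i := (0 < u (low_var (n + i)))%N && (0 < u (high_var (n + i)))%N.
  exists (\sum_(i <- L (ch eps)) U_(i))%MM; first by apply/gensE; exists eps.
  have gt0 i : (i < n)%N -> (0 < u (low_var (idx eps i)))%N && (0 < u (high_var (idx eps i)))%N.
    by move=> lt_i; have := up i lt_i; rewrite /idx /eps; case: ifP => // _; rewrite orbF.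
  apply/(squarefree_le _ (uL _)) => z /inL[e <- [j lt_j eE]].
  have [i [] ji] := parity_cases j; rewrite ji in eE.
    have lt_i : (i < n)%N by lia.
    rewrite lowE // in eE; rewrite -(edge_varE eE).
    by have /andP[] := gt0 i lt_i.
  have lt_i : (i < n)%N by lia.
  rewrite highE // in eE; rewrite -(edge_varE eE).
  by have /andP[] := gt0 i lt_i.
Qed.

End EdgeGenerators.

(** * Coprime monomials and the invariants of the two ideals *)

Section DisjointMonomials.
Variable m : nat.
Implicit Types (p q r u : 'X_{1..m}) (a b c : 'I_m).

Lemma disjoint_mnmC p q : disjoint_mnm p q -> disjoint_mnm q p.
Proof. by move=> pq i; case: (pq i); auto. Qed.

Lemma disjoint_mnm0 q : disjoint_mnm 0%MM q.
Proof. by move=> i; rewrite mnm0E; left. Qed.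

Lemma disjoint_mnmD p q r : disjoint_mnm p r -> disjoint_mnm q r -> disjoint_mnm (p + q)%MM r.
Proof.
move=> pr qr i; rewrite mnmDE.
by case: (pr i) => [-> | ->]; [case: (qr i) => ->; auto | auto].
Qed.

Lemma disjoint_mnmU a b : a <> b -> disjoint_mnm U_(a)%MM U_(b)%MM.
Proof.
move=> /eqP ab i; rewrite !mnm1E; have [ai | _] := eqVneq a i; last by left.
by right; rewrite -ai eq_sym (negPf ab).
Qed.

Lemma disjoint_mnm_sum (L : seq 'I_m) q :
  (forall i, i \in L -> disjoint_mnm U_(i)%MM q) -> disjoint_mnm (\sum_(i <- L) U_(i))%MM q.
Proof.
move=> Lq; rewrite big_seq; apply: (big_ind (fun p => disjoint_mnm p q)) => //; first exact: disjoint_mnm0.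
by move=> *; apply: disjoint_mnmD.
Qed.

Lemma disjoint_mnmU2 a a' b b' : a <> b -> a <> b' -> a' <> b -> a' <> b' ->
  disjoint_mnm (U_(a) + U_(a'))%MM (U_(b) + U_(b'))%MM.
Proof.
move=> ab ab' a'b a'b'; apply: disjoint_mnmD; apply: disjoint_mnmC;
by apply: disjoint_mnmD; apply: disjoint_mnmC; apply: disjoint_mnmU.
Qed.

Lemma lemU2 a b u : a <> b ->
  (U_(a) + U_(b) <= u)%MM = (0 < u a)%N && (0 < u b)%N.
Proof.
move=> /eqP ab; have uL : uniq [:: a; b] by rewrite /= inE ab.
have -> : (U_(a) + U_(b) = \sum_(i <- [:: a; b]) U_(i))%MM.
  by rewrite !big_cons big_nil addm0.
apply/(squarefree_le u uL)/andP => [gt0 | [gta gtb] i].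
  by split; apply: gt0; rewrite !inE eqxx ?orbT.
by rewrite !inE => /orP[]/eqP->.
Qed.
End DisjointMonomials.

(** Here [p0 = 0] and [e = 2]; the value for the ideal is [n * 3], one more than the regularity of
    the quotient. *)
Lemma polarized_pd_reg (k : fieldType) m (G : {mpoly k[m]} -> Prop) n (x x' : nat -> 'I_m) :
  (0 < n)%N ->
  (forall f, f \in ideal_gen G <-> monomial_ideal (polarized_mnm n x x') f) ->
  (forall i j, (i < n + n)%N -> (j < n + n)%N -> x i = x j -> i = j) ->
  (forall i j, (i < n + n)%N -> (j < n + n)%N -> x' i = x' j -> i = j) ->
  (forall i j, (i < n + n)%N -> (j < n + n)%N -> x i <> x' j) ->
  is_pd (quot_ideal G) n.+1 /\ is_reg (quot_homog G) (3 * n - 1)%N.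
Proof.
move=> n_gt0 GE x_inj x'_inj xx'.
pose p i : 'X_{1..m} := (U_(x i) + U_(x' i))%MM.
have disj i j : (i < n + n)%N -> (j < n + n)%N -> i <> j -> disjoint_mnm (p i) (p j).
  move=> lt_i lt_j nij; apply: disjoint_mnmU2.
  - by move/x_inj => /(_ lt_i lt_j).
  - exact: xx'.
  - by move/esym; apply: xx'.
  - by move/x'_inj => /(_ lt_i lt_j).
apply: (@pairs_pd_reg k m 0%MM p (fun i => p (n + i)%N) n 2) => //.
- by move=> i lt_i; rewrite mdegD !mdeg1.
- by move=> i lt_i; rewrite mdegD !mdeg1.
- by move=> i lt_i; apply: disj; lia.
- by move=> i lt_i; split; apply: disjoint_mnm0.
- by move=> i j lt_ij; split; apply: disj; lia.
- move=> f; rewrite GE; apply: eq_monomial_ideal => u; split=> [Eu | [_ Eu]].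
    split=> [|i lt_i]; first by apply/mnm_lepP => i; rewrite mnm0E.
    by rewrite !lemU2; [apply: Eu | apply: xx'; lia | apply: xx'; lia].
  by move=> i lt_i; have := Eu i lt_i; rewrite !lemU2 //; apply: xx'; lia.
- by rewrite mdeg0; lia.
Qed.

(** Here [p0] is the product of the [n + 1] marked variables and [e = 1]; the value for the ideal is
    [(n + 1) + n]. *)
Lemma marked_pairs_pd_reg (k : fieldType) m (G : {mpoly k[m]} -> Prop) n (v : nat -> 'I_m) :
  (0 < n)%N ->
  (forall f, f \in ideal_gen G <-> monomial_ideal (marked_pairs_mnm n v) f) ->
  (forall i j, (i < 3 * n + 1)%N -> (j < 3 * n + 1)%N -> v i = v j -> i = j) ->
  is_pd (quot_ideal G) n.+1 /\ is_reg (quot_homog G) (2 * n)%N.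
Proof.
move=> n_gt0 GE v_inj.
pose L := [seq v i | i <- iota 0 n.+1].
have uL : uniq L.
  rewrite map_inj_in_uniq ?iota_uniq // => i j; rewrite !mem_iota => lt_i lt_j.
  by apply: v_inj; lia.
have v_neq i j : (i < 3 * n + 1)%N -> (j < 3 * n + 1)%N -> i <> j -> v i <> v j.
  by move=> lt_i lt_j nij /v_inj; auto.
have disjL i : (n < i < 3 * n + 1)%N ->
    disjoint_mnm (\sum_(i <- L) U_(i))%MM U_(v i)%MM.
  move=> lt_i; apply: disjoint_mnm_sum => _ /mapP[j + ->]; rewrite mem_iota => lt_j.
  by apply: disjoint_mnmU; apply: v_neq; lia.
apply: (@pairs_pd_reg k m (\sum_(i <- L) U_(i))%MM
  (fun i => U_(v (n.+1 + i)%N)%MM) (fun i => U_(v (2 * n + 1 + i)%N)%MM) n 1) => //.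
- by move=> i _; rewrite mdeg1.
- by move=> i _; rewrite mdeg1.
- by move=> i lt_i; apply: disjoint_mnmU; apply: v_neq; lia.
- by move=> i lt_i; split; apply: disjL; lia.
- by move=> i j lt_ij; split; apply: disjoint_mnmU; apply: v_neq; lia.
- move=> f; rewrite GE; apply: eq_monomial_ideal => u.
  split=> [[Ev Ep] | [/(squarefree_le u uL) Ev Ep]]; split.
  + apply/(squarefree_le u uL) => z /mapP[i]; rewrite mem_iota => lt_i ->.
    by apply: Ev; lia.
  + move=> i lt_i; rewrite !lep1mP -!lt0n; have := Ep (n.+1 + i)%N.
    have -> : (n + (n.+1 + i) = 2 * n + 1 + i)%N by lia.
    by apply; lia.
  + by move=> i lt_i; apply: Ev; apply: map_f; rewrite mem_iota; lia.
  + move=> i lt_i; have := Ep (i - n.+1)%N; rewrite !lep1mP -!lt0n.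
    have -> : (n.+1 + (i - n.+1) = i)%N by lia.
    have -> : (2 * n + 1 + (i - n.+1) = n + i)%N by lia.
    by apply; lia.
- have -> : mdeg (\sum_(i <- L) U_(i))%MM = n.+1.
    rewrite mdeg_sum (eq_bigr (fun=> 1%N)) => [|i _]; last by rewrite mdeg1.
    by rewrite sum1_size size_map size_iota.
  by lia.
Qed.

Local Close Scope ring_scope.

Theorem corollary5p8 (n : nat) (hn : (1 <= n)%N) (k : fieldType)
    (y : hasse_edge (diamond n) -> 'I_(4 * n)) (hy : bijective y)
    (x : diamond n -> 'I_(3 * n + 1)) (hx : bijective x) :
  [/\ is_pd (quot_ideal (LD_gens k y)) (n + 1) /\
      is_pd (quot_ideal (path_gens k (2 * n + 1) x)) (n + 1),
      is_reg (quot_homog (LD_gens k y)) (Posz (3 * n - 1)) /\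
      is_reg (quot_homog (path_gens k (2 * n + 1) x)) (Posz (2 * n))
    & is_depth (quot_ideal (LD_gens k y)) graded_max_ideal (3 * n - 1) /\
      is_depth (quot_ideal (path_gens k (2 * n + 1) x)) graded_max_ideal
        (2 * n)].
Proof.
have [el elK] := dcode_inv hn.
have low_inj := low_var_inj (n_gt0 := hn) elK hy.
have high_inj := high_var_inj (n_gt0 := hn) elK hy.
have low_high := low_high_neq (n_gt0 := hn) elK hy.
have LDE := @LD_genE _ hn k _ elK _ hy; have pathE := @path_genE _ hn k _ elK _ hx.
have [pdLD regLD] := polarized_pd_reg hn LDE low_inj high_inj low_high.
have [pdpath regpath] := marked_pairs_pd_reg hn pathE (path_var_inj hn elK hx).
rewrite addn1; split=> //; split.
  (* [n + n] differences depolarize, [n.-1] glue. *)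
  have -> : (3 * n - 1 = n + n + n.-1)%N by lia.
  apply: (polarized_depth hn _ LDE _ low_inj high_inj low_high) => //.
    by apply: monomial_ideal_closed => u w up i lt_i; have := up i lt_i; rewrite !mnmDE; lia.
  by move=> z; apply: (edge_var_surj hn elK hy).
apply: (marked_pairs_depth _ pathE _ (path_var_inj hn elK hx)) => //.
  apply: monomial_ideal_closed => u w [Ev Ep]; split=> i lt_i.
    by have := Ev i lt_i; rewrite mnmDE; lia.
  by have := Ep i lt_i; rewrite !mnmDE; lia.
exact: (path_var_surj hn elK hx).
Qed.
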